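(* Let $C(\mathbf{R})$ be the space of continuous functions $\mathbf{R}\to\mathbf{R}$ with the compact-open topology, let $d_\infty(f,g)=\sup_{x\in\mathbf{R}}|f(x)-g(x)|\in[0,\infty]$, and let $E_\infty=\{(f,g)\mid d_\infty(f,g)<\infty\}$. Then: (i) the metric equivalence relation $(d_\infty,E_\infty)$ on $C(\mathbf{R})$ is turbulent; (ii) $E_\infty$ is generically $E^Y_{S_\infty}$-ergodic for every Polish $S_\infty$-space $Y$; (iii) $E_\infty\not\le_B E^Y_G$ for every Polish group $G$ and every Polish $G$-space $Y$.
   Context: A metric equivalence relation $(d,E_d)$ on a topological space $X$: $d:X\times X\to[0,\infty]$ a metric, $E_d=\{d<\infty\}$, with uniformity generated by $V_\epsilon=\{d<\epsilon\}$. For non-empty open $U\subset X$ and an entourage $V\subset E_d$ of this uniformity, the local equivalence class of $x\in U$ is its class under $\bigcup_{n\ge0}(V\cap(U\times U))^n$. $(d,E_d)$ is turbulent if every class of $E_d$ is dense in $X$, every class is meager in $X$, and every local equivalence class is somewhere dense in $X$ (topology of $X$, here compact-open). $E^Y_G$ is the orbit relation of a continuous action of a Polish group $G$ on a Polish space $Y$; $S_\infty$ is the Polish group of permutations of $\mathbf{N}$. For equivalence relations $E$ on $X$, $F$ on $Y$, $\theta:X\to Y$ is $(E,F)$-invariant if $xEx'\Rightarrow\theta(x)F\theta(x')$; $E$ is generically $F$-ergodic if for each $(E,F)$-invariant Baire measurable $\theta$ there is a residual $E$-saturated $C\subset X$ with $\theta(C)$ in a single $F$-class; $E\le_B F$ if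 there is an $(E,F)$-invariant Borel $\theta$ inducing an injective map $X/E\to Y/F$. *)

(* Defs.v *)
From HB Require Import structures.
From mathcomp Require Import all_boot all_order all_algebra.
From mathcomp Require Import all_classical all_reals all_analysis.

Set Implicit Arguments.
Unset Strict Implicit.
Unset Printing Implicit Defensive.

Import Order.TTheory GRing.Theory Num.Theory.
Import numFieldNormedType.Exports.

Local Open Scope classical_set_scope.
Local Open Scope ring_scope.

Section Category.
Context {T : topologicalType}.
Implicit Types A C : set T.

Definition somewhere_dense A := (closure A)° !=set0.

Definition nowhere_dense A := (closure A)° = set0.

Definition meager A :=
  exists2 F : (set T)^nat, (forall n, nowhere_dense (F n)) & A = \bigcup_n F n.

Definition residual A := meager (~` A).

Definition Baire_property A :=
  exists2 U, open U & meager ((A `\` U) `|` (U `\` A)).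

End Category.

Definition Baire_measurable {X Y : topologicalType} (f : X -> Y) :=
  forall O : set Y, open O -> Baire_property (f @^-1` O).

(* The library's g_sigma_algebraType is only measurable over a pointed type,
   and a Polish space may be empty. *)
Definition Borel_function {X Y : topologicalType} (f : X -> Y) :=
  forall B : set Y, <<s open >> B -> <<s open >> (f @^-1` B).

(* metricType fixes one metric, whereas a Polish topology is only required to
   be induced by some complete metric. *)
Definition polish (R : realType) (T : topologicalType) :=
  (exists2 D : set T, countable D & dense D) /\
  exists d : T -> T -> R,
    [/\ [/\ forall x y, d x y = 0 <-> x = y,
            forall x y, d x y = d y x &
            forall x y z, d x z <= d x y + d y z],
        forall x : T, nbhs x =
          filter_from [set e : R | 0 < e] (fun e => [set y | d x y < e]) &
        forall u : T^nat,
          (forall e : R, 0 < e -> exists N, forall m n,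
             (N <= m)%N -> (N <= n)%N -> d (u m) (u n) < e) ->
          exists l : T, u @ \oo --> l].

HB.mixin Record isTopologicalGroup G of Group G & Topological G := {
  mulg_continuous : continuous (fun gh : G * G => (gh.1 * gh.2)%g) ;
  invg_continuous : continuous (fun g : G => (g^-1)%g)
}.

#[short(type="topologicalGroupType")]
HB.structure Definition TopologicalGroup :=
  {G of Group G & Topological G & isTopologicalGroup G}.

Record continuous_action (G : topologicalGroupType) (Y : topologicalType) := {
  act :> G -> Y -> Y ;
  act1 : forall y, act 1%g y = y ;
  actM : forall g h y, act (g * h)%g y = act g (act h y) ;
  act_continuous : continuous (fun gy : G * Y => act gy.1 gy.2)
}.

Definition orbit_relation (G : topologicalGroupType) (Y : topologicalType)
    (a : continuous_action G Y) (y z : Y) : Prop := exists g : G, a g y = z.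

(* The inverse is carried as data; it is determined by the function. *)
Record Sinf := MkSinf {
  sfun :> nat -> nat ;
  sinv : nat -> nat ;
  sfunK : cancel sfun sinv ;
  sinvK : cancel sinv sfun
}.

Section SinfGroup.

Lemma SinfP (s t : Sinf) : sfun s =1 sfun t -> s = t.
Proof.
case: s t => [s s' ss' s's] [t t' tt' t't] /= /funext st; subst t.
have st' : s' = t'.
  by apply/funext => n; apply: (can_inj ss'); rewrite s's t't.
by subst t'; congr MkSinf; exact: Prop_irrelevance.
Qed.

HB.instance Definition _ := gen_eqMixin Sinf.
HB.instance Definition _ := gen_choiceMixin Sinf.

Definition Sinf_one : Sinf := @MkSinf id id (fun=> erefl) (fun=> erefl).

Definition Sinf_inv (s : Sinf) : Sinf := MkSinf (@sinvK s) (@sfunK s).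

Definition Sinf_mul (s t : Sinf) : Sinf :=
  @MkSinf (s \o t) (sinv t \o sinv s)
    (can_comp (@sfunK s) (@sfunK t)) (can_comp (@sinvK t) (@sinvK s)).

Lemma Sinf_mulA : associative Sinf_mul.
Proof. by move=> s t u; exact: SinfP. Qed.

Lemma Sinf_mul1g : left_id Sinf_one Sinf_mul.
Proof. by move=> s; exact: SinfP. Qed.

Lemma Sinf_mulg1 : right_id Sinf_one Sinf_mul.
Proof. by move=> s; exact: SinfP. Qed.

Lemma Sinf_mulVg : left_inverse Sinf_one Sinf_inv Sinf_mul.
Proof. by move=> s; apply: SinfP => n /=; exact: sfunK. Qed.

Lemma Sinf_mulgV : right_inverse Sinf_one Sinf_inv Sinf_mul.
Proof. by move=> s; apply: SinfP => n /=; exact: sinvK. Qed.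

HB.instance Definition _ := isGroup.Build Sinf
  Sinf_mulA Sinf_mul1g Sinf_mulg1 Sinf_mulVg Sinf_mulgV.

End SinfGroup.

(* Pointwise convergence, with nat discrete. *)
HB.instance Definition _ := Topological.copy Sinf
  (initial_topology (sfun : Sinf -> {ptws nat -> nat})).

Section SinfTopology.

Lemma nbhs_Sinf_eval (s : Sinf) n : \forall t \near s, sfun t n = sfun s n.
Proof.
have : continuous (fun t : Sinf => sfun t n).
  move=> t; apply: (@continuous_comp _ {ptws nat -> nat} nat sfun (fun f => f n)).
    exact: initial_continuous.
  exact: (@proj_continuous nat (fun=> nat)).
by move=> /(_ s [set sfun s n]); apply.
Qed.

Lemma continuous_to_Sinf (T : topologicalType) (f : T -> Sinf) :
  (forall x n, \forall y \near x, sfun (f y) n = sfun (f x) n) -> continuous f.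
Proof.
move=> fP; apply: continuous_comp_initial => x.
apply/cvg_sup => n; apply/cvg_image; first by apply/seteqP; split => // k _; exists (fun=> k).
move=> A; rewrite /= nbhs_principalE => /principal_filterP An.
exists [set g : nat -> nat | A (g n)].
  by apply: filterS (fP x n) => y /= ->.
by apply/seteqP; split=> [k [g /= Ag <-//]|k Ak]; exists (fun=> k).
Qed.

Lemma Sinf_mulg_continuous : continuous (fun gh : Sinf * Sinf => (gh.1 * gh.2)%g).
Proof.
apply: continuous_to_Sinf => -[s t] n.
exists ([set s' | sfun s' (sfun t n) = sfun s (sfun t n)],
        [set t' | sfun t' n = sfun t n]).
  by split; exact: nbhs_Sinf_eval.
by case=> s' t' /= [s's t't]; rewrite t't.
Qed.

Lemma Sinf_invg_continuous : continuous (fun g : Sinf => (g^-1)%g).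
Proof.
apply: continuous_to_Sinf => s n.
apply: filterS (nbhs_Sinf_eval s (sinv s n)) => t /=.
by rewrite sinvK => {1}<-; rewrite sfunK.
Qed.

HB.instance Definition _ := isTopologicalGroup.Build Sinf
  Sinf_mulg_continuous Sinf_invg_continuous.

End SinfTopology.

Section InvariantMaps.
Context {X Y : topologicalType}.
Variables (E : X -> X -> Prop) (F : Y -> Y -> Prop).

Definition invariant_map (theta : X -> Y) :=
  forall x x', E x x' -> F (theta x) (theta x').

Definition saturated (C : set X) := forall x x', C x -> E x x' -> C x'.

Definition generically_ergodic :=
  forall theta : X -> Y, invariant_map theta -> Baire_measurable theta ->
    exists C : set X, [/\ residual C, saturated C &
      exists y : Y, theta @` C `<=` [set y' | F y y']].

Definition Borel_reducible :=
  exists theta : X -> Y, [/\ invariant_map theta, Borel_function theta &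
    forall x x', F (theta x) (theta x') -> E x x'].

End InvariantMaps.

Record metric_equivalence (R : realType) (X : Type) := {
  medist :> X -> X -> \bar R ;
  medist_ge0 : forall x y, (0 <= medist x y)%E ;
  medist_eq0 : forall x y, medist x y = 0%E <-> x = y ;
  medist_sym : forall x y, medist x y = medist y x ;
  medist_triangle : forall x y z, (medist x z <= medist x y + medist y z)%E
}.

Section MetricEquivalence.
Context {R : realType} {X : topologicalType}.
Variable d : metric_equivalence R X.

Definition merel (x y : X) : Prop := (d x y < +oo)%E.

Definition meentourage : set_system (X * X) :=
  filter_from [set e : R | 0 < e]
    (fun e => [set xy | (d xy.1 xy.2 < e%:E)%E]).

Definition relation_power (A : set (X * X)) (n : nat) : set (X * X) :=
  iter n (fun B => (B \; A)%relation) diagonal.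

(* V need not be symmetric; since the inverse of an entourage is again one,
   quantifying over all V covers both directions of the chains. *)
Definition local_class (U : set X) (V : set (X * X)) (x : X) : set X :=
  [set y | (\bigcup_n relation_power (V `&` U `*` U) n) (x, y)].

Definition turbulent :=
  [/\ forall x, dense [set y | merel x y],
      forall x, meager [set y | merel x y] &
      forall (U : set X) (V : set (X * X)), open U -> U !=set0 ->
        meentourage V -> V `<=` [set xy | merel xy.1 xy.2] ->
        forall x, U x -> somewhere_dense (local_class U V x)].

End MetricEquivalence.

Definition CR (R : realType) : Type := continuousType R R.

HB.instance Definition _ (R : realType) := Topological.copy (CR R)
  (initial_topology (id : continuousType R R -> {compact-open, R -> R})).

Section SupMetric.
Context {R : realType}.
Implicit Types f g h : CR R.

Definition dinf f g : \bar R :=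
  ereal_sup [set `|f x - g x|%:E | x in [set: R]].

Lemma dinf_ge f g x : (`|f x - g x|%:E <= dinf f g)%E.
Proof. by apply: ereal_sup_ubound; exists x. Qed.

Lemma dinf_ge0 f g : (0 <= dinf f g)%E.
Proof. by apply: le_trans (dinf_ge f g 0); rewrite lee_fin. Qed.

Lemma dinf_eq0 f g : dinf f g = 0%E <-> f = g.
Proof.
split=> [d0|->].
  apply/continuousEP => x; apply/eqP; rewrite -subr_eq0 -normr_le0 -(lee_fin _ (0:R)).
  by rewrite -[X in (_ <= X)%E]d0; exact: dinf_ge.
apply/eqP; rewrite eq_le dinf_ge0 andbT.
by apply: ge_ereal_sup => _ [x _ <-]; rewrite subrr normr0.
Qed.

Lemma dinf_sym f g : dinf f g = dinf g f.
Proof. by congr ereal_sup; apply: eq_imagel => x _; rewrite distrC. Qed.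

Lemma dinf_triangle f g h : (dinf f h <= dinf f g + dinf g h)%E.
Proof.
apply: ge_ereal_sup => _ [x _ <-].
apply: (@le_trans _ _ (`|f x - g x|%:E + `|g x - h x|%:E)%E).
  by rewrite -EFinD lee_fin; exact: ler_distD.
by apply: leeD; exact: dinf_ge.
Qed.

End SupMetric.

Definition dinf_metric (R : realType) : metric_equivalence R (CR R) :=
  Build_metric_equivalence (@dinf_ge0 R) (@dinf_eq0 R) (@dinf_sym R)
    (@dinf_triangle R).

Definition Einf {R : realType} (f g : CR R) : Prop := merel (dinf_metric R) f g.

(* Main.v *)
Require Import Defs.
From HB Require Import structures.
From mathcomp Require Import all_boot all_order all_algebra.
From mathcomp Require Import all_classical all_reals all_analysis.
From mathcomp Require Import ring lra.

(** The sup-distance classes are rich enough that a single local fact serves both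
  ergodicity and irreducibility. Let f map E_oo-classes into orbits of a group G
  admitting countable covers by small pieces, and perturb x to
  x + e (squash b - squash a), where squash maps R onto (-1, 1) and the
  parameters a, b range over the Baire space C(R). Countably many translates of
  a neighbourhood of 1 cover G, and analytic sets have the Baire property; hence,
  by Kuratowski-Ulam, for generic x and for generic parameters in suitable open
  sets, f (x + e (squash b - squash a)) lies in W f(x) for a prescribed
  neighbourhood W of 1. The topology of C(R) sees only compact sets, so e can be
  taken as large as desired.

  (iii) Letting e grow, choose x_n in a generic set, converging in C(R), with
  f(x_n) = s_n f(x_0), s_n converging to s in G, and |x_n - x_0| large far away.
  Then f(lim x_n) = s f(x_0), although lim x_n - x_0 is unbounded.

  (ii) In S_oo the neighbourhoods W may be taken to be subgroups. The closure of
  the set of y in the class of x with f(y) in W f(x) is then stable under small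
  uniform steps inside a tube around x, hence contains that tube. A back and
  forth between generic x_0 and y_0 produces a common limit z with
  f(z) = s f(x_0) = t f(y_0).

  (i) The segment from x to a point of its class stays in a convex tube and
  splits into arbitrarily small uniform steps. *)

Set Implicit Arguments.
Unset Strict Implicit.
Unset Printing Implicit Defensive.

Import Order.TTheory GRing.Theory Num.Theory.
Import numFieldNormedType.Exports.

Local Open Scope classical_set_scope.
Local Open Scope ring_scope.

(** * Meager and residual sets *)

Section Meager.
Context {T : topologicalType}.
Implicit Types A B : set T.

Lemma nowhere_dense_sub A B : A `<=` B -> nowhere_dense B -> nowhere_dense A.
Proof.
by move=> AB; rewrite /nowhere_dense -!subset0 => B0; apply: subset_trans B0;
  exact/interiorS/closureS.
Qed.

Lemma meagerP A :
  (exists2 F : (set T)^nat, (forall n, nowhere_dense (F n)) & A `<=` \bigcup_n F n) ->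
  meager A.
Proof.
move=> [F ndF AF]; exists (fun n => A `&` F n).
  by move=> n; apply: nowhere_dense_sub (ndF n) => x [].
by rewrite -setI_bigcupr; apply/seteqP; split=> [x Ax|x []//]; split=> //; exact: AF.
Qed.

Lemma meager_sub A B : A `<=` B -> meager B -> meager A.
Proof. by move=> AB [F ndF BF]; apply: meagerP; exists F => //; rewrite -BF. Qed.

Lemma nowhere_dense_meager A : nowhere_dense A -> meager A.
Proof. by move=> ndA; apply: meagerP; exists (fun=> A) => // x Ax; exists 0%N. Qed.

Lemma nowhere_dense0 : nowhere_dense (@set0 T).
Proof. by rewrite /nowhere_dense closure0 interior0. Qed.

Lemma meager_bigcup (I : countType) (F : I -> set T) :
  (forall i, meager (F i)) -> meager (\bigcup_i F i).
Proof.
move=> mF.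
have /choice[G GF] : forall i, exists G : (set T)^nat,
    (forall n, nowhere_dense (G n)) /\ F i = \bigcup_n G n.
  by move=> i; have [G ? ?] := mF i; exists G.
apply: meagerP.
exists (fun k => if @unpickle (I * nat)%type k is Some p then G p.1 p.2 else set0).
  by move=> k; case: unpickle => [p|]; [exact: (GF p.1).1 | exact: nowhere_dense0].
move=> x [i _]; rewrite (GF i).2 => -[n _ Gx].
by exists (pickle (i, n)) => //; rewrite pickleK.
Qed.

Lemma meagerU A B : meager A -> meager B -> meager (A `|` B).
Proof.
move=> mA mB; apply: (@meager_sub _ (\bigcup_(b : bool) (if b then A else B))).
  by move=> x [Ax|Bx]; [exists true | exists false].
by apply: meager_bigcup => -[].
Qed.

Lemma residual_sub A B : A `<=` B -> residual A -> residual B.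
Proof. by move=> AB; apply: meager_sub; exact: subsetC. Qed.

Lemma residual_bigcap (I : countType) (F : I -> set T) :
  (forall i, residual (F i)) -> residual (\bigcap_i F i).
Proof. by move=> rF; rewrite /residual setC_bigcap; exact: meager_bigcup. Qed.

Lemma residualI A B : residual A -> residual B -> residual (A `&` B).
Proof. by move=> rA rB; rewrite /residual setCI; exact: meagerU. Qed.

Lemma residualT : residual [set: T].
Proof. by rewrite /residual setCT; exact/nowhere_dense_meager/nowhere_dense0. Qed.

Lemma open_dense_residual A : open A -> dense A -> residual A.
Proof.
move=> oA dA; apply: nowhere_dense_meager.
rewrite /nowhere_dense -(closure_id _).1; last exact: open_closedC.
rewrite -subset0 => x Ax.
have [y [yA Ay]] : (~` A)° `&` A !=set0 by apply: dA; [exists x | exact: open_interior].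
by have := interior_subset yA; apply.
Qed.

Lemma residual_dense_open A : residual A ->
  exists2 V : (set T)^nat, (forall n, open (V n) /\ dense (V n)) & \bigcap_n V n `<=` A.
Proof.
move=> [F ndF AF]; exists (fun n => ~` closure (F n)).
  move=> n; split; first by apply: closed_openC; exact: closed_closure.
  move=> O O0 oO; apply: contrapT => /asboolPn/asboolPn OF.
  have : O `<=` (closure (F n))°.
    rewrite -open_subsetE// => x Ox; apply: contrapT => Fx; apply: OF; by exists x.
  rewrite ndF => OF0; have [x Ox] := O0; exact: (OF0 _ Ox).
move=> x Vx; apply: contrapT => Ax.
have : (~` A) x by [].
rewrite AF => -[n _ Fx]; apply: (Vx n) => //; exact: subset_closure.
Qed.

Lemma closed_boundary_nowhere_dense (L : set T) : closed L -> nowhere_dense (L `\` L°).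
Proof.
move=> cL; rewrite /nowhere_dense -(closure_id _).1; last first.
  by apply: closedI => //; apply: open_closedC; exact: open_interior.
rewrite -subset0 => x xL.
have xL' : (L°) x by apply: filterS xL => y [].
by have [_] := interior_subset xL.
Qed.

Lemma second_countable_seq : @second_countable T ->
  exists2 O : (set T)^nat, (forall n, open (O n)) &
    forall x N, nbhs x N -> exists2 n, O n x & O n `<=` N.
Proof.
move=> [B cB [oB nB]].
have [f injf] : exists f : set T -> nat, {in B &, injective f}.
  by have /countable_injP[f finj] := cB; exists f => //; exact/inj_set.
(* [f] is injective on [B], so this union has at most one member; it is empty when [n] codes no
   basic set. *)
pose O n := \bigcup_(A in [set A | B A /\ f A = n]) A.
exists O; first by move=> n; apply: bigcup_open => A [/oB].
move=> x N /nB[A [BA Ax] AN]; exists (f A); first by exists A.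
move=> y [A' [BA' ff] A'y]; apply: AN.
by rewrite -(injf A' A) ?inE.
Qed.

Lemma seq_second_countable (O : (set T)^nat) : (forall n, open (O n)) ->
  (forall x N, nbhs x N -> exists2 n, O n x & O n `<=` N) -> @second_countable T.
Proof.
move=> oO nO; exists (range O); first exact: sub_countable (card_image_le _ _) (countableP _).
split; first by move=> _ [n _ <-]; exact: oO.
by move=> x N /nO[n Onx OnN]; exists (O n) => //; split => //; exists n.
Qed.

End Meager.

Definition Baire_space (T : topologicalType) := forall A : set T, residual A -> dense A.

(** * Products and the Kuratowski-Ulam theorem *)

Section Products.
Context {T1 T2 : topologicalType}.

Lemma open_setX (A : set T1) (B : set T2) : open A -> open B -> open (A `*` B).
Proof.
move=> oA oB; rewrite openE => -[x y] [Ax By]; exists (A, B) => //.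
by split; exact: open_nbhs_nbhs.
Qed.

Lemma second_countable_prod : @second_countable T1 -> @second_countable T2 ->
  @second_countable (T1 * T2)%type.
Proof.
move=> /second_countable_seq[B oB nB] /second_countable_seq[P oP nP].
apply: (@seq_second_countable _ (fun k => if @unpickle (nat * nat)%type k is Some p
   then B p.1 `*` P p.2 else set0)).
  move=> k; case: unpickle => [p|]; last exact: open0.
  exact: open_setX.
move=> [x y] N [[A C] /= [xA yC] AC].
have [i Bx BA] := nB _ _ xA; have [j Py PC] := nP _ _ yC.
exists (pickle (i, j)); rewrite pickleK//= => -[a b] [/= /BA ? /PC ?]; exact: AC.
Qed.

(** One half of Kuratowski-Ulam. A fibre of the dense open set [V n] is dense once it meets every
    nonempty basic set [B k]; the base points where it meets [B k] form a projection of an open set,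
    dense because [V n] is dense in the product. *)
Lemma residual_prod (A : set (T1 * T2)) : @second_countable T2 -> residual A ->
  residual [set x | residual [set y | A (x, y)]].
Proof.
move=> /second_countable_seq[B oB nB] /residual_dense_open[V odV VA].
pose D n k := [set x : T1 | B k !=set0 -> exists2 y, B k y & V n (x, y)].
apply: (@residual_sub _ (\bigcap_n \bigcap_k D n k)).
  move=> x Dx; apply: (@residual_sub _ (\bigcap_n [set y | V n (x, y)])).
    by move=> y Vy; apply: VA => n _; exact: Vy.
  apply: residual_bigcap => n; apply: open_dense_residual.
    apply: (@open_comp _ _ (pair x)); last exact: (odV n).1.
    by move=> y _; apply: cvg_pair; [exact: cvg_cst | exact: cvg_id].
  move=> U [y Uy] oU; have [k By BU] := nB y U (open_nbhs_nbhs (conj oU Uy)).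
  have [|z Bz Vz] := Dx n I k I; first by exists y.
  by exists z; split => //; exact: BU.
apply: residual_bigcap => n; apply: residual_bigcap => k.
have [Bk0|/set0P Bk0] := eqVneq (B k) set0.
  by apply: residual_sub residualT => x _; rewrite /D /= Bk0 => -[].
have -> : D n k = fst @` (V n `&` setT `*` B k).
  apply/seteqP; split=> [x /(_ Bk0)[y By Vy]|_ [[x y] [Vxy [_ By]] <-] _].
    by exists (x, y).
  by exists y.
apply: open_dense_residual.
  apply: fst_open; apply: openI; first exact: (odV n).1.
  by apply: open_setX => //; exact: openT.
move=> U [x Ux] oU; have [y By] := Bk0.
have [||[a b] [[Ua Bb] Vab]] := (odV n).2 (U `*` B k).
- by exists (x, y).
- exact: open_setX.
by exists a; split => //; exists (a, b).
Qed.

Lemma Baire_space_prod : @second_countable T2 -> Baire_space T1 -> Baire_space T2 ->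
  Baire_space (T1 * T2)%type.
Proof.
move=> sc2 b1 b2 A rA O [[x y] Oxy] oO.
have [[U V] /= [xU yV] UV] : nbhs (x, y) O by exact: open_nbhs_nbhs.
have [||a [Ua /b2 ra]] := b1 _ (residual_prod sc2 rA) U°.
- by exists x.
- exact: open_interior.
have [||b [Vb Aab]] := ra V°.
- by exists y.
- exact: open_interior.
exists (a, b); split => //; apply: UV; split; exact: interior_subset.
Qed.

(** The sections give density: an open set around [t] is pulled back along the section through [t]
    to an open set around [p t], which meets each [V n]. *)
Lemma residual_preimage (p : T1 -> T2) (A : set T2) : continuous p ->
  (forall t, exists2 s : T2 -> T1, continuous s & s (p t) = t /\ cancel s p) ->
  residual A -> residual (p @^-1` A).
Proof.
move=> cp sp /residual_dense_open[V odV VA].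
apply: (@residual_sub _ (\bigcap_n p @^-1` V n)).
  by move=> x Vx; apply: VA => n; exact: Vx.
apply: residual_bigcap => n; apply: open_dense_residual.
  by apply: open_comp => [x _|]; [exact: cp | exact: (odV n).1].
move=> O [t Ot] oO; have [s cs [st sK]] := sp t.
have [||z [Oz Vz]] := (odV n).2 (s @^-1` O).
- by exists (p t); rewrite /preimage /= st.
- by apply: open_comp => [x _|//]; exact: cs.
by exists (s z); split => //; rewrite /preimage /= sK.
Qed.

End Products.

(** * The Baire property of projections *)

Section BaireProperty.
Context {T : topologicalType}.
Implicit Types A : set T.

Lemma Baire_propertyP A :
  Baire_property A <-> exists2 U, open U & residual [set x | A x <-> U x].
Proof.
split=> -[U oU mU]; exists U => //.
  apply: meager_sub mU => x /= /not_andP[/not_implyP[Ax Ux]|/not_implyP[Ux Ax]].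
    by left.
  by right.
apply: meager_sub mU => x [[Ax Ux] /= AU|[Ux Ax] AU]; first by apply: Ux; exact/AU.
by apply: Ax; exact/AU.
Qed.

Lemma Baire_property_open A : open A -> Baire_property A.
Proof.
by move=> oA; apply/Baire_propertyP; exists A => //; apply: residual_sub residualT.
Qed.

Lemma Baire_propertyC A : Baire_property A -> Baire_property (~` A).
Proof.
move=> /Baire_propertyP[U oU rU]; apply/Baire_propertyP.
exists (~` U)°; first exact: open_interior.
have rC : residual (~` (~` U `\` (~` U)°)).
  rewrite /residual setCK; apply: nowhere_dense_meager.
  exact/closed_boundary_nowhere_dense/open_closedC.
apply: residual_sub (residualI rU rC) => x [/= [AU UA] nU]; split=> [Ax|Ux Ax].
  by apply: contrapT => Ux; apply: nU; split => // /UA.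
by apply: (interior_subset Ux); exact: AU.
Qed.

Lemma Baire_property_bigcup (F : (set T)^nat) :
  (forall n, Baire_property (F n)) -> Baire_property (\bigcup_n F n).
Proof.
move=> bF; have /choice[U FU] : forall n, exists U, open U /\ residual [set x | F n x <-> U x].
  by move=> n; have /Baire_propertyP[U ? ?] := bF n; exists U.
apply/Baire_propertyP; exists (\bigcup_n U n).
  by apply: bigcup_open => n _; exact: (FU n).1.
apply: residual_sub (residual_bigcap (fun n => (FU n).2)) => x xF.
by split=> -[n _ /(xF n I) ?]; exists n.
Qed.

Lemma Borel_Baire_property A : <<s open >> A -> Baire_property A.
Proof.
apply: smallest_sub => [|B]; last exact: Baire_property_open.
split=> [|B bB|]; first exact/Baire_property_open/open0.
  by rewrite setTD; exact: Baire_propertyC.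
exact: Baire_property_bigcup.
Qed.

End BaireProperty.

Lemma Borel_Baire_measurable {X Y : topologicalType} (f : X -> Y) :
  Borel_function f -> Baire_measurable f.
Proof.
by move=> bf U oU; apply: Borel_Baire_property; apply: bf => A [_]; exact.
Qed.

(** A Baire measurable map is continuous on a residual set: discard the meager errors between
    preimages of basic sets and open sets. The residual set is kept as an explicit intersection of
    dense open sets, so that limits of sequences can be steered into it. *)
Lemma Baire_measurable_continuous {X Y : topologicalType} (f : X -> Y) :
  @second_countable Y -> Baire_measurable f ->
  exists2 V : (set X)^nat, (forall n, open (V n) /\ dense (V n)) &
    forall x N, (\bigcap_n V n) x -> nbhs (f x) N ->
      nbhs x [set x' | (\bigcap_n V n) x' -> N (f x')].
Proof.
move=> /second_countable_seq[B oB nB] mf.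
have /choice[U fU] : forall n, exists U,
    open U /\ residual [set x | B n (f x) <-> U x].
  by move=> n; have /Baire_propertyP[U ? ?] := mf _ (oB n); exists U.
have [V odV VU] := residual_dense_open (residual_bigcap (fun n => (fU n).2)).
exists V => // x N /VU xU /nB[n Bx BN].
have Ux : U n x by exact/(xU n I).
apply: filterS (open_nbhs_nbhs (conj (fU n).1 Ux)) => x' Ux' /VU x'U.
by apply: BN; exact/(x'U n I).
Qed.

(* The common ground of Polish groups and [Sinf]: the pieces of stage n form a
   countable cover, cb n s plays the part of the closed ball of radius 2^-n
   around s. *)
Record complete_base (G : topologicalType) := {
  cb : nat -> G -> set G ;
  cb_piece : nat -> nat -> set G ;
  cb_nbhs : forall n s, nbhs s (cb n s) ;
  cb_closed : forall n s, closed (cb n s) ;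
  cb_small : forall s N, nbhs s N -> exists n, cb n s `<=` N ;
  cb_cover : forall n s, exists k, cb_piece n k s ;
  cb_pieceP : forall n k s, cb_piece n k s -> cb_piece n k `<=` cb n s ;
  cb_complete : forall u : G^nat, (forall n, cb n (u n) (u n.+1)) ->
    exists l : G, u @ \oo --> l
}.

Lemma complete_base_dense (G : topologicalType) (c : complete_base G) (g0 : G) :
  exists D : nat -> G, forall (g : G) N, nbhs g N -> exists n, N (D n).
Proof.
have /choice[d dP] : forall p : nat * nat, exists x,
    forall y, cb_piece c p.1 p.2 y -> cb_piece c p.1 p.2 x.
  move=> p; have [[x px]|np] := pselect (exists x, cb_piece c p.1 p.2 x).
    by exists x.
  by exists g0 => y py; case: np; exists y.
exists (fun k => if unpickle k is Some p then d p else g0) => g N.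
move=> /(cb_small c)[n nN]; have [k kg] := cb_cover c n g.
exists (pickle (n, k)); rewrite pickleK; apply: nN.
exact: (cb_pieceP kg) (dP (n, k) _ kg).
Qed.

Section Projection.
Context {T Z : topologicalType} (c : complete_base Z).
Hypothesis scT : @second_countable T.

(** A closed hull up to meager error: it contains [A] except for a meager part
    ([meager_not_locally]) and lies in the closure of [A]. *)
Definition locally_nonmeager (A : set T) :=
  [set t : T | forall N, nbhs t N -> ~ meager (A `&` N)].

Lemma closed_locally_nonmeager A : closed (locally_nonmeager A).
Proof.
move=> t At N /nbhs_interior Nt; have [s [As Ns]] := At _ Nt.
by apply: contra_not (As _ Ns) => mN; exact: mN.
Qed.

Lemma locally_nonmeager_closure A : locally_nonmeager A `<=` closure A.
Proof.
move=> t At N /At; apply: contra_notP => AN; apply: meager_sub residualT.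
by move=> s ANs; exfalso; apply: AN; exists s.
Qed.

(** Each point concerned has a basic neighbourhood in which [A] is meager, and there are countably
    many basic sets. *)
Lemma meager_not_locally A : meager (A `\` locally_nonmeager A).
Proof.
have [B oB nB] := second_countable_seq scT.
pose F n := [set x | A x /\ B n x /\ meager (A `&` B n)].
apply: (@meager_sub _ _ (\bigcup_n F n)); last first.
  apply: meager_bigcup => n; have [mB|nmB] := pselect (meager (A `&` B n)).
    by apply: meager_sub mB => x [? []].
  by apply: meager_sub residualT => x [_ [_ /nmB]].
move=> x [Ax /existsNP[N /not_implyP[/nB[n Bx BN] /contrapT mN]]].
by exists n => //; split=> //; split=> //; apply: meager_sub mN; exact: setIS.
Qed.

(** Even the interiors of the sets [locally_nonmeager (F k)] leave out only a nowhere dense part: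
    near an interior point of that part, [A] would be covered by the meager remainders of the [F k]
    and by boundaries of closed sets. *)
Lemma meager_locally_split (A : set T) (F : (set T)^nat) : A `<=` \bigcup_k F k ->
  meager (locally_nonmeager A `\` \bigcup_k locally_nonmeager (F k)).
Proof.
move=> AF; pose V := \bigcup_k (locally_nonmeager (F k))°.
have oV : open V by apply: bigcup_open => k _; exact: open_interior.
apply: (@meager_sub _ _ (locally_nonmeager A `\` V)).
  by move=> t [At nt]; split=> // -[k _ /interior_subset kt]; apply: nt; exists k.
apply: nowhere_dense_meager; rewrite /nowhere_dense -(closure_id _).1; last first.
  by apply: closedI; [exact: closed_locally_nonmeager | exact: open_closedC].
rewrite -subset0 => t tL.
have [At _] := interior_subset tL.
apply: (At _ (nbhs_interior tL)).
apply: (@meager_sub _ _ (\bigcup_k ((F k `\` locally_nonmeager (F k)) `|`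
    (locally_nonmeager (F k) `\` (locally_nonmeager (F k))°)))).
  move=> s [/AF[k _ Fs] /interior_subset[_ Vs]]; exists k => //.
  have [Ls|Ls] := pselect (locally_nonmeager (F k) s); last by left.
  by right; split => // Lis; apply: Vs; exists k.
apply: meager_bigcup => k; apply: meagerU; first exact: meager_not_locally.
apply: nowhere_dense_meager; apply: closed_boundary_nowhere_dense.
exact: closed_locally_nonmeager.
Qed.

(* The Souslin operation: t is in the projection once all the pieces along some
   branch kappa meet the fibre over t locally nonmeagerly. *)
Lemma projection_Baire_property (D : set T) (F : set (T * Z)) : residual D ->
  (forall t z, D t -> closure F (t, z) -> F (t, z)) ->
  Baire_property [set t | exists z, F (t, z)].
Proof.
move=> rD clF.
(* [A s] projects the part of [F] whose second coordinate lies in the pieces numbered by [s], stage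
   by stage. *)
pose A s := [set t | exists z, F (t, z) /\
  forall i, (i < size s)%N -> cb_piece c i (nth 0 s i) z].
have A0 : A [::] = [set t | exists z, F (t, z)].
  by apply/seteqP; split=> t [z]; [case=> Fz _; exists z | exists z; split].
have AS s : A s `<=` \bigcup_k A (rcons s k).
  move=> t [z [Fz sz]]; have [k kz] := cb_cover c (size s) z.
  exists k => //; exists z; split => // i.
  rewrite size_rcons ltnS nth_rcons leq_eqVlt => /predU1P[->|ilt].
    by rewrite ltnn eqxx.
  by rewrite ilt; exact: sz.
pose M s := locally_nonmeager (A s).
(* Outside the meager set [E], [A s] is contained in [M s], and a point of [M s] lies in some
   [M (rcons s k)]; a branch can thus be followed forever. *)
pose E := \bigcup_s ((A s `\` M s) `|` (M s `\` \bigcup_k M (rcons s k))).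
have rE : residual (~` E).
  rewrite /residual setCK; apply: meager_bigcup => s; apply: meagerU.
    exact: meager_not_locally.
  by apply: meager_locally_split; exact: AS.
rewrite -A0; apply/Baire_propertyP.
exists (M [::])°; first exact: open_interior.
have rM : residual (~` (M [::] `\` (M [::])°)).
  rewrite /residual setCK; apply: nowhere_dense_meager.
  exact/closed_boundary_nowhere_dense/closed_locally_nonmeager.
apply: residual_sub (residualI rD (residualI rE rM)) => t [Dt [/= nE nM]]; split.
  move=> At; apply: contrapT => Mt; apply: nE; exists [::] => //; left; split => //.
  by move=> Mt'; apply: nM.
move=> /interior_subset M0t.
have /choice[g gP] : forall s, exists k, M s t -> M (rcons s k) t.
  move=> s; have [Ms|nMs] := pselect (M s t); last by exists 0%N.
  apply: contrapT => /forallNP nk; apply: nE; exists s => //; right; split=> //.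
  by move=> [k _ Mk]; apply: (nk k).
pose sq n := iter n (fun s => rcons s (g s)) [::].
pose kappa i := g (sq i).
have sqE n : sq n = mkseq kappa n.
  by elim: n => // n IHn; rewrite mkseqS -IHn.
have Msq n : M (sq n) t by elim: n => //= n; exact: gP.
have [B oB nB] := second_countable_seq scT.
pose N n := [set y | forall i, (i < n)%N -> B i t -> B i y].
have nN n : nbhs t (N n).
  elim: n => [|n IHn]; first by apply: filterS filterT.
  have nn : nbhs t [set y | B n t -> B n y].
    have [Bt|nBt] := pselect (B n t); last by apply: filterS filterT => y _ /nBt.
    by apply: filterS (open_nbhs_nbhs (conj (oB n) Bt)) => y ? _.
  apply: filterS (filterI IHn nn) => y [Ny ny] i; rewrite ltnS leq_eqVlt.
  by move=> /predU1P[->//|]; exact: Ny.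
(* [M (sq n)] lies in the closure of [A (sq n)]: this gives points of [F] whose first coordinates
   tend to [t] and whose second ones follow the branch, hence converge by [cb_complete]. *)
have /choice[p pP] : forall n, exists p : T * Z, [/\ F p, N n p.1 &
    forall i, (i <= n)%N -> cb_piece c i (kappa i) p.2].
  move=> n; have [y [[z [Fz zs]] Ny]] := locally_nonmeager_closure (Msq n.+1) (nN n).
  exists (y, z); split => // i ilen; rewrite sqE size_mkseq in zs.
  by have := zs i; rewrite nth_mkseq//; exact.
have [n|z pz] := @cb_complete _ c (fun n => (p n).2).
  have [_ _ pn] := pP n; have [_ _ pn1] := pP n.+1.
  by apply: (cb_pieceP (pn n _)) => //; exact: pn1.
exists z; split => //; apply: clF => // W [[P Q] /= [Pt Qz] PQ].
have [i Bt BP] := nB _ _ Pt.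
have [n _ Qn] := pz _ Qz.
have [Fp Np _] := pP (maxn n i.+1).
exists (p (maxn n i.+1)); split=> //; apply: PQ; split=> /=.
  by apply: BP; apply: Np => //; rewrite leq_max leqnn orbT.
by apply: Qn => /=; rewrite leq_maxl.
Qed.

End Projection.

(** * The compact-open topology of C(R) *)

Section CompactOpen.
Context {R : realType}.
Implicit Types x y z a b : CR R.

(** For [d > 0] the tubes form a base of neighbourhoods of [x] ([nbhs_tube], [nbhsCR]). *)
Definition tube x (m : nat) (d : R) : set (CR R) :=
  [set z | forall r : R, `|r| <= m%:R -> `|z r - x r| <= d].

Lemma tube_refl x m (d : R) : 0 < d -> tube x m d x.
Proof. by move=> d0 r _; rewrite subrr normr0 ltW. Qed.

Lemma tubeS x m n (d e : R) : (m <= n)%N -> d <= e -> tube x n d `<=` tube x m e.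
Proof.
move=> mn de z xz r rm; apply: le_trans de; apply: xz.
by rewrite (le_trans rm)// ler_nat.
Qed.

Lemma cts_CR x : continuous x.
Proof. by move=> r; exact: (@cts_fun _ _ (x : continuousType R R)). Qed.

Definition CR_of (f : R -> R) (cf : continuous f) : CR R :=
  (mkcts cf : continuousType R R).

Lemma itv_natP (m : nat) (r : R) : (`[- m%:R, m%:R]%classic : set R) r <-> `|r| <= m%:R.
Proof. by rewrite /= in_itv /= ler_norml. Qed.

(** Compactness of [[-m, m]], with [d] tending to 0 from the right as the parameter of the covering;
    [s] may lie slightly outside the interval. *)
Lemma CR_unif_continuous x (m : nat) (e : R) : 0 < e ->
  exists2 d : R, 0 < d & forall r s : R, `|r| <= m%:R -> `|s - r| <= d ->
    `|x s - x r| <= e.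
Proof.
move=> e0.
have /compact_near_coveringP cK := @segment_compact R (- m%:R) m%:R.
have := cK R (0 : R)^'+ (fun d r => forall s : R, `|s - r| <= d -> `|x s - x r| <= e) _.
case=> [r _|d /= d0 dP].
  have := @cts_CR x r; move=> /cvgrPdist_le /(_ (e / 2)).
  rewrite divr_gt0// => /(_ isT) [d /= d0 dP].
  exists ([set r' | `|r - r'| < d / 2], [set t | t < d / 2]).
    split; last by apply: nbhs_right_lt; rewrite divr_gt0.
    by exists (d / 2) => //=; rewrite divr_gt0.
  move=> [r' t] [/= rr' td] s st.
  rewrite -(subrKA (x r)) (le_trans (ler_normD _ _))// [leRHS](splitr e) lerD//.
    rewrite distrC; apply: dP => /=.
    rewrite -(subrKA r') (le_lt_trans (ler_normD _ _))// [ltRHS](splitr d) ltrD//.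
    by rewrite distrC (le_lt_trans st).
  apply: dP => /=; rewrite (lt_trans rr')//.
  by rewrite ltr_pdivrMr// ltr_pMr// ltr1n.
exists (d / 2); first by rewrite divr_gt0.
move=> r s /itv_natP rm; apply: dP => //=; last by rewrite divr_gt0.
by rewrite sub0r normrN gtr0_norm ?divr_gt0// ltr_pdivrMr// ltr_pMr// ltr1n.
Qed.

Lemma CR_bounded_itv x (m : nat) :
  exists2 b : R, 0 < b & forall r : R, `|r| <= m%:R -> `|x r| <= b.
Proof.
have : compact (x @` `[- m%:R, m%:R]).
  apply: continuous_compact; last exact: segment_compact.
  exact/continuous_subspaceT/cts_CR.
move=> /(@compact_bounded R R) [M [Mr MP]]; exists (Num.max (M + 1) 1).
  by rewrite lt_max ltr01 orbT.
move=> r rm; apply: (MP (Num.max (M + 1) 1)).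
  by rewrite lt_max ltrDl ltr01.
by exists r => //; exact/itv_natP.
Qed.

Lemma nbhs_tube x m (d : R) : 0 < d -> nbhs x (tube x m d).
Proof.
move=> d0.
pose F : set_system (R -> R) := nbhs (x : {compact-open, R -> R}).
have FF : Filter F by exact: (@nbhs_filter {compact-open, R -> R} (x : R -> R)).
have : {family compact, F --> (x : R -> R)}.
  by apply/compact_open_fam_compactP => //; exact: cts_CR.
move=> /fam_cvgP /(_ _ (@segment_compact R (- m%:R) m%:R)).
move=> /(_ [set z : R -> R | forall r : R, `|r| <= m%:R -> `|z r - x r| <= d]) FP.
apply: (@initial_continuous _ _ (id : CR R -> {compact-open, R -> R})).
apply: FP; apply/uniform_nbhs; exists [set uv : R * R | `|uv.2 - uv.1| < d].
split; last by move=> h xh r /itv_natP/xh/ltW.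
by exists d => // -[u v] /=; rewrite distrC.
Qed.

Lemma nbhsCR x N : nbhs x N -> exists m, exists2 d : R, 0 < d & tube x m d `<=` N.
Proof.
move=> [_ [[B oB <-] /= Bx] BN].
pose T (md : nat * R) := [set z : R -> R |
  forall r : R, `|r| <= md.1%:R -> `|z r - x r| <= md.2].
pose F : set_system (R -> R) := filter_from [set md : nat * R | 0 < md.2] T.
have FF : Filter F.
  apply: filter_from_filter; first by exists (0%N, 1) => /=.
  move=> [m d] [n e] /= d0 e0; exists (maxn m n, Num.min d e) => /=.
    by rewrite lt_min d0.
  move=> z zP; split => r rm.
    apply: (le_trans (zP r _)); last by rewrite /= ge_min lexx.
    by rewrite (le_trans rm)// ler_nat leq_maxl.
  apply: (le_trans (zP r _)); last by rewrite /= ge_min lexx orbT.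
  by rewrite (le_trans rm)// ler_nat leq_maxr.
have : {compact-open, F --> (x : R -> R)}.
  apply/compact_open_fam_compactP; first exact: cts_CR.
  apply/fam_cvgP => K /(@compact_bounded R R) [M [Mr MP]] P.
  move=> /uniform_nbhs[E [[d /= d0 dE] EP]].
  exists ((Num.truncn (Num.max (M + 1) 1)).+1, d / 2) => /=; first by rewrite divr_gt0.
  move=> z zP; apply: EP => r Kr; apply: dE; rewrite /= distrC.
  apply: le_lt_trans (zP r _) _ => /=; last by rewrite ltr_pdivrMr// ltr_pMr// ltr1n.
  have := MP (Num.max (M + 1) 1); rewrite lt_max ltrDl ltr01 => /(_ isT r Kr) rM.
  by rewrite (le_trans rM)// ltW// truncnS_gt.
move=> /(_ B) []; first exact: open_nbhs_nbhs.
by move=> [m d] /= d0 TB; exists m, d => // z zP; apply/BN/TB.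
Qed.

Lemma continuous_to_CR (T : topologicalType) (f : T -> CR R) :
  (forall t m (d : R), 0 < d -> nbhs t [set s | tube (f t) m d (f s)]) -> continuous f.
Proof.
move=> fP t N /nbhsCR[m [d d0 dN]]; apply: filterS (fP t m d d0) => s; exact: dN.
Qed.

Lemma CR_second_countable : @second_countable (CR R).
Proof.
pose e k : R := k.+1%:R^-1.
have e0 k : 0 < e k by rewrite /e invr_gt0.
(* The code [c] is a step function: mesh [1 / c.1.+1] from [-m] on, values the multiples of [e k]
   listed in [c.2]. One [e k] pays for oscillation on a mesh interval, one for rounding. *)
pose A m k (c : nat * seq int) := [set z : CR R | forall r : R, `|r| <= m%:R ->
  `|z r - (nth 0 c.2 (Num.truncn ((r + m%:R) * c.1.+1%:R)))%:~R * e k| <= e k + e k].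
have coverA m k z : exists c, A m k c z.
  have [d d0 dP] := CR_unif_continuous z m (e0 k).
  pose p := Num.truncn d^-1; pose q : R := p.+1%:R.
  have q0 : 0 < q by [].
  have qd : q^-1 <= d by rewrite -[leRHS]invrK lef_pV2 ?posrE ?invr_gt0// ltW// truncnS_gt.
  pose t (i : nat) : R := i%:R / q - m%:R.
  exists (p, mkseq (fun i => Num.floor (z (t i) / e k)) (m.*2 * p.+1).+1) => r rm /=.
  set i := Num.truncn _.
  have rm0 : 0 <= (r + m%:R) * q.
    by rewrite mulr_ge0// -lerBlDr sub0r; move: rm; rewrite ler_norml => /andP[].
  have /andP[ir ri] : i%:R <= (r + m%:R) * q < i.+1%:R by exact: truncn_itv.
  rewrite nth_mkseq; last first.
    rewrite ltnS -(ler_nat R) (le_trans ir)// natrM ler_wpM2r// -addnn natrD lerD2r.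
    by move: rm; rewrite ler_norml => /andP[].
  have tr : t i <= r by rewrite /t lerBlDr ler_pdivrMr.
  have rt : r - t i <= q^-1.
    rewrite /t opprB addrA lerBlDr.
    have -> : q^-1 + i%:R / q = i.+1%:R / q by rewrite -nat1r mulrDl mul1r.
    by rewrite ler_pdivlMr// ltW.
  have tm : `|t i| <= m%:R.
    rewrite ler_norml (le_trans tr) ?andbT; last by move: rm; rewrite ler_norml => /andP[].
    by rewrite /t lerBrDr addNr divr_ge0.
  rewrite -(subrKA (z (t i))) (le_trans (ler_normD _ _))// lerD//.
    by apply: dP => //; rewrite ger0_norm ?subr_ge0// (le_trans rt).
  have zE : z (t i) = z (t i) / e k * e k by rewrite divfK// gt_eqF.
  rewrite {1}zE -mulrBl normrM (gtr0_norm (e0 k)) ler_piMl// ?ltW//.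
  have /andP[fl flS] := floor_itv (z (t i) / e k).
  rewrite ger0_norm ?subr_ge0// ltrBlDl.
  by move: flS; rewrite intrD1 addrC.
have /choice[w wP] : forall c : nat * nat * (nat * seq int), exists z,
    forall z', A c.1.1 c.1.2 c.2 z' -> A c.1.1 c.1.2 c.2 z.
  move=> c; have [[z cz]|nc] := pselect (exists z, A c.1.1 c.1.2 c.2 z).
    by exists z.
  by exists (CR_of (@cst_continuous R R 0)) => z' cz'; case: nc; exists z'.
have Atube m k c z z' : A m k c z -> A m k c z' -> tube z m (e k *+ 4) z'.
  move=> zA z'A r rm; have := zA r rm; have := z'A r rm; set u := _ * e k => z'u zu.
  rewrite -(subrKA u) (le_trans (ler_normD _ _))// (mulrnDr _ 2 2) lerD//.
  by rewrite distrC.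
(* Two members of a class differ by at most [4 e k] on [[-m, m]]; radius [8 e k] around the chosen
   member leaves room for a [4 e k] tube about any other one, and [12 e k <= d] keeps everything in
   [N]. *)
apply: (@seq_second_countable _ (fun n => if unpickle n is Some c then
  (tube (w c) c.1.1 (e c.1.2 *+ 8))° else set0)).
  by move=> n; case: unpickle => [c|]; [exact: open_interior | exact: open0].
move=> x N /nbhsCR[m [d d0 dN]].
pose k := Num.truncn ((d / 12)^-1).
have kd : e k *+ 12 <= d.
  rewrite -mulr_natr -ler_pdivlMr// /e -[leRHS]invrK lef_pV2 ?posrE ?invr_gt0 ?divr_gt0//.
  by rewrite ltW// truncnS_gt.
have [c cx] := coverA m k x.
have cw := wP (m, k, c) _ cx.
exists (pickle (m, k, c)); rewrite pickleK /=.
  apply: filterS (nbhs_tube x m (_ : 0 < e k *+ 4)); last by rewrite pmulrn_lgt0.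
  move=> z xz r rm; rewrite -(subrKA (x r)) (mulrnDr _ 4 4).
  rewrite (le_trans (ler_normD _ _))// lerD//; first exact: xz.
  exact: (Atube _ _ _ _ _ cw cx).
move=> z /interior_subset wz; apply: dN => r rm; apply: le_trans kd.
rewrite -(subrKA (w (m, k, c) r)) (le_trans (ler_normD _ _))// (mulrnDr _ 8 4) lerD//.
  exact: wz.
exact: (Atube _ _ _ _ _ cx cw).
Qed.

End CompactOpen.

(** Dependent choice along stages: [P] is the invariant, [Q] the link between consecutive states.
    The limit constructions below are instances. *)
Lemma dependent_choice_nat (X : Type) (P : nat -> X -> Prop) (Q : nat -> X -> X -> Prop)
    (x0 : X) : P 0%N x0 ->
  (forall n x, P n x -> exists y, P n.+1 y /\ Q n x y) ->
  exists u : nat -> X, u 0%N = x0 /\ forall n, P n (u n) /\ Q n (u n) (u n.+1).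
Proof.
move=> P0 PQ.
pose S (a b : nat * X) := b.1 = a.1.+1 /\ (P a.1 a.2 -> P b.1 b.2 /\ Q a.1 a.2 b.2).
have [|f [f0 fS]] := @dependent_choice _ S _ (0%N, x0).
  move=> [n x]; apply: cid; have [Px|nPx] := pselect (P n x); last by exists (n.+1, x).
  by have [y PQy] := PQ _ _ Px; exists (n.+1, y).
have f1 n : (f n).1 = n by elim: n => [|n IHn]; rewrite ?f0// (fS n).1 IHn.
have fP n : P n (f n).2.
  elim: n => [|n IHn]; first by rewrite f0.
  by have := (fS n).2; rewrite f1 => /(_ IHn)[]; rewrite f1.
exists (fun n => (f n).2); split; first by rewrite f0.
by move=> n; split => //; have := (fS n).2; rewrite f1 => /(_ (fP n))[].
Qed.

(** * Limits in C(R) and the Baire category theorem *)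

Section Completeness.
Context {R : realType}.
Implicit Types x y z : CR R.

Lemma ex_inv_nat (e : R) (N : nat) : 0 < e ->
  exists2 n, (N <= n)%N & n.+1%:R^-1 <= e.
Proof.
move=> e0; exists (maxn N (Num.truncn e^-1)); first exact: leq_maxl.
rewrite -[leRHS]invrK lef_pV2 ?posrE ?invr_gt0//.
by rewrite (le_trans (ltW (truncnS_gt _)))// ler_nat ltnS leq_maxr.
Qed.

(** The radii tend to 0 and the intervals exhaust the line, so convergence is locally uniform; the
    non-strict inequalities defining the tubes pass to the limit. *)
Lemma tube_limit (x : nat -> CR R) (m : nat -> nat) (d : nat -> R) :
  (forall n, (n <= m n)%N) -> (forall n, d n <= n.+1%:R^-1) ->
  (forall n j, (n <= j)%N -> tube (x n) (m n) (d n) (x j)) ->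
  exists z, x @ \oo --> z /\ forall n, tube (x n) (m n) (d n) z.
Proof.
move=> nm dn xj.
have xr (r : R) N (e : R) : 0 < e -> exists2 n, (N <= n)%N & (`|r| <= (m n)%:R) /\ d n <= e.
  move=> e0; have [n] := ex_inv_nat (maxn N (Num.truncn `|r|).+1) e0.
  rewrite geq_max => /andP[Nn rn] ne; exists n => //; split.
    by rewrite (le_trans (ltW (truncnS_gt _)))// ler_nat (leq_trans rn).
  exact: le_trans ne.
have cvgx (r : R) : cvg ((fun n => x n r) @ \oo).
  apply/cauchy_cvgP/cauchy_exP => e e0.
  have [n _ [rm de]] := xr r 0%N (e / 2) (divr_gt0 e0 (ltr0Sn _ _)).
  exists (x n r); exists n => // j /= nj; rewrite -ball_normE /= distrC.
  by rewrite (le_lt_trans (xj n j nj r rm))// (le_lt_trans de)// gtr_pMr// invf_lt1// ltr1n.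
pose z (r : R) := lim ((fun n => x n r) @ \oo).
have zx (r : R) n : `|r| <= (m n)%:R -> `|z r - x n r| <= d n.
  move=> rm; apply/ler_addgt0Pr => e e0.
  have /cvgrPdist_le/(_ e e0)[N _ NP] := cvgx r.
  rewrite [leRHS]addrC -(subrKA (x (maxn n N) r)) (le_trans (ler_normD _ _))// lerD//.
    by apply: NP; rewrite /= leq_maxr.
  by apply: xj => //; exact: leq_maxl.
have cz : continuous z.
  move=> r; apply/cvgrPdist_le => e e0.
  have e3 : 0 < e / 3 by rewrite divr_gt0.
  have [n _ [rm de]] := xr (`|r| + 1) 0%N _ e3.
  have := @cts_CR _ (x n) r; move=> /cvgrPdist_le /(_ _ e3) xn.
  have r1 : \forall s \near r, `|r - s| <= 1 by exact: (@cvgr_dist_le _ _ _ _ _ id r cvg_id).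
  apply: filterS (filterI xn r1) => s [xs rs].
  have Pm (t : R) : `|t| <= `|r| + 1 -> `|t| <= (m n)%:R.
    by move=> h; rewrite (le_trans h)// (le_trans _ rm)// ler_norm.
  have sm : `|s| <= (m n)%:R.
    by apply: Pm; rewrite -lerBlDl (le_trans (lerB_dist _ _))// distrC.
  have rm' : `|r| <= (m n)%:R by apply: Pm; rewrite lerDl.
  have -> : e = e / 3 + e / 3 + e / 3 by field.
  rewrite -(subrKA (x n s)) (le_trans (ler_normD _ _))// lerD//.
    rewrite -(subrKA (x n r)) (le_trans (ler_normD _ _))// lerD//.
    exact: le_trans (zx _ _ rm') de.
  by rewrite distrC (le_trans (zx _ _ sm)).
exists (CR_of cz); split=> [N /nbhsCR[p [e e0 eN]]|n r rm]; last exact: zx.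
have [n pn ne] := ex_inv_nat p (divr_gt0 e0 (ltr0Sn _ 1)).
exists n => // j /= nj; apply: eN => r rp.
have rm : `|r| <= (m n)%:R by rewrite (le_trans rp)// ler_nat (leq_trans pn).
rewrite -(subrKA (x n r)) (le_trans (ler_normD _ _))// [leRHS]splitr lerD//.
  by rewrite (le_trans (xj n j nj r rm))// (le_trans (dn n)).
by rewrite distrC (le_trans (zx _ _ rm))// (le_trans (dn n)).
Qed.

Lemma small_tube x N n : nbhs x N ->
  exists m, exists2 d : R, 0 < d & [/\ (n <= m)%N, d <= n.+1%:R^-1 & tube x m d `<=` N].
Proof.
move=> /nbhsCR[m [d d0 dN]]; exists (maxn n m), (Num.min d n.+1%:R^-1).
  by rewrite lt_min d0 invr_gt0 ltr0n.
split; [exact: leq_maxl | by rewrite ge_min lexx orbT |].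
by apply: subset_trans dN; apply: tubeS; rewrite ?leq_maxr// ge_min lexx.
Qed.

Lemma CR_Baire_space : Baire_space (CR R).
Proof.
move=> A /residual_dense_open[V odV VA] O [x0 Ox0] oO.
pose P (n : nat) (s : CR R * set (CR R)) := nbhs s.1 s.2.
(* Each new neighbourhood lies in a tube that itself lies in the old neighbourhood and in [V n]; the
   limit then lies in every [V n]. *)
pose Q (n : nat) (s s' : CR R * set (CR R)) := s'.2 `<=` s.2 `&` V n /\
  exists m d, [/\ (n <= m)%N, d <= n.+1%:R^-1 :> R & s'.2 `<=` tube s'.1 m d] /\
  tube s'.1 m d `<=` s.2 `&` V n.
have [||u [u0 uPQ]] := @dependent_choice_nat _ P Q (x0, O).
- exact: (open_nbhs_nbhs (conj oO Ox0)).
- move=> n [x N] /= xN.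
  have [||y [Ny Vy]] := (odV n).2 N°; [by exists x | exact: open_interior |].
  have yNV : nbhs y (N `&` V n).
    by apply: filterI => //; apply: open_nbhs_nbhs; split=> //; exact: (odV n).1.
  have [m [d d0 [nm dn dN]]] := small_tube n yNV.
  exists (y, tube y m d); split; first exact: nbhs_tube.
  split => //=; exists m, d; split => //; split => //.
have /choice[m /choice[d md]] := fun n => (uPQ n).2.2.
have uS n j : (n <= j)%N -> (u j).2 `<=` (u n).2.
  elim: j => [|j IHj]; first by rewrite leqn0 => /eqP->.
  rewrite leq_eqVlt => /predU1P[->//|/IHj jn].
  by apply: subset_trans jn => y /((uPQ j).2.1)[].
have [||n j nj|z [_ zt]] := @tube_limit (fun n => (u n.+1).1) m d.
- by move=> n; case: (md n) => -[].
- by move=> n; case: (md n) => -[].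
- have [[_ _ ut] _] := md n; apply: ut; apply: (uS n.+1 j.+1) => //.
  exact: nbhs_singleton (uPQ j.+1).1.
have zV n : ((u n).2 `&` V n) z by have [_] := md n; apply.
exists z; split; last by apply: VA => n _; have [] := zV n.
by have [] := zV 0%N; rewrite u0.
Qed.

End Completeness.

(** * Bounded perturbations *)

Section Squash.
Context {R : realType}.
Implicit Types s t : R.

Definition squash t : R := t / (1 + `|t|).

Definition unsquash t : R := t / (1 - `|t|).

Let den_gt0 t : 0 < 1 + `|t|. Proof. by rewrite ltr_pwDl. Qed.

Lemma squash0 : squash 0 = 0. Proof. by rewrite /squash mul0r. Qed.

Lemma norm_squash t : `|squash t| = `|t| / (1 + `|t|).
Proof. by rewrite normrM normfV (gtr0_norm (den_gt0 _)). Qed.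

Lemma squash_lt1 t : `|squash t| < 1.
Proof. by rewrite norm_squash ltr_pdivrMr// mul1r ltrDr. Qed.

Let lip_aux s t : `|(s - t) + (s * (`|t| - `|s|) - (t - s) * `|s|)| <=
  `|s - t| * (1 + 2 * `|s|).
Proof.
have ts : `| `|t| - `|s| | <= `|s - t| by rewrite distrC ler_dist_dist.
have := ler_normD (s - t) (s * (`|t| - `|s|) - (t - s) * `|s|).
have := ler_normB (s * (`|t| - `|s|)) ((t - s) * `|s|).
rewrite (normrM s) (normrM (t - s)) normr_id (distrC t s).
by have := normr_ge0 s; nra.
Qed.

Lemma squash_lip s t : `|squash s - squash t| <= 2 * `|s - t|.
Proof.
have s0 := den_gt0 s; have t0 := den_gt0 t.
have -> : squash s - squash t =
    ((s - t) + (s * (`|t| - `|s|) - (t - s) * `|s|)) / ((1 + `|s|) * (1 + `|t|)).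
  by rewrite /squash; field; rewrite !gt_eqF.
rewrite normrM normfV (gtr0_norm (mulr_gt0 _ _))// ler_pdivrMr ?mulr_gt0//.
apply: le_trans (lip_aux s t) _.
have := normr_ge0 s; have := normr_ge0 t; have := normr_ge0 (s - t).
move: `|s - t| `|t| `|s| => u v w u0 v0 w0.
have : 0 <= u * v * (1 + w) by rewrite !mulr_ge0// addr_ge0.
by nra.
Qed.

Lemma unsquashK t : `|t| < 1 -> squash (unsquash t) = t.
Proof.
move=> t1; have d0 : 0 < 1 - `|t| by rewrite subr_gt0.
have n0 : `|unsquash t| = `|t| / (1 - `|t|).
  by rewrite normrM normfV (gtr0_norm d0).
rewrite /squash n0 /unsquash; field.
by rewrite subrK oner_neq0 gt_eqF.
Qed.

(** [unsquash] has poles at 1 and -1, so the constant depends on the margin [1 - c]; the factor 3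
    comes from the numerator. *)
Lemma unsquash_lip c s t : c < 1 -> `|s| <= c -> `|t| <= c ->
  `|unsquash s - unsquash t| <= 3 / (1 - c) ^+ 2 * `|s - t|.
Proof.
move=> c1 sc tc.
have c0 : 0 < 1 - c by rewrite subr_gt0.
have cs : 1 - c <= 1 - `|s| by rewrite lerB.
have ct : 1 - c <= 1 - `|t| by rewrite lerB.
have s0 := lt_le_trans c0 cs; have t0 := lt_le_trans c0 ct.
have -> : unsquash s - unsquash t =
    ((s - t) + (- s * (`|t| - `|s|) - (s - t) * `|s|)) / ((1 - `|s|) * (1 - `|t|)).
  by rewrite /unsquash; field; rewrite !gt_eqF.
have num : `|(s - t) + (- s * (`|t| - `|s|) - (s - t) * `|s|)| <= 3 * `|s - t|.
  have ts : `| `|t| - `|s| | <= `|s - t| by rewrite distrC ler_dist_dist.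
  have := ler_normD (s - t) (- s * (`|t| - `|s|) - (s - t) * `|s|).
  have := ler_normB (- s * (`|t| - `|s|)) ((s - t) * `|s|).
  rewrite (normrM (- s)) (normrM (s - t)) normr_id normrN.
  by have := normr_ge0 s; have := normr_ge0 (s - t); nra.
rewrite normrM normfV (gtr0_norm (mulr_gt0 _ _))// ler_pdivrMr ?mulr_gt0//.
apply: le_trans num _.
have -> : 3 / (1 - c) ^+ 2 * `|s - t| * ((1 - `|s|) * (1 - `|t|)) =
    3 * `|s - t| * ((1 - `|s|) * (1 - `|t|) / (1 - c) ^+ 2).
  by field; rewrite gt_eqF.
by rewrite ler_peMr ?mulr_ge0// ler_pdivlMr ?exprn_gt0// mul1r expr2 ler_pM// ltW.
Qed.

Lemma continuous_squash : continuous squash.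
Proof.
move=> t; apply: cvgM; first exact: cvg_id.
apply: cvgV; first by rewrite gt_eqF.
by apply: cvgD; [exact: cvg_cst | exact: norm_continuous].
Qed.

End Squash.

Section Moves.
Context {R : realType}.
Implicit Types x y z a b : CR R.

Lemma Einf_bounded x y (B : R) : (forall r, `|x r - y r| <= B) -> Einf x y.
Proof.
move=> xy; apply: (@le_lt_trans _ _ B%:E); last exact: ltry.
by apply: ge_ereal_sup => _ [r _ <-]; rewrite lee_fin.
Qed.

Lemma Einf_bound x y : Einf x y -> exists B : R, forall r, `|x r - y r| <= B.
Proof.
move=> xy; exists (fine (dinf x y)) => r; rewrite -lee_fin fineK ?dinf_ge//.
by rewrite ge0_fin_numE ?dinf_ge0.
Qed.

Lemma Einf_sym x y : Einf x y -> Einf y x.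
Proof. by rewrite /Einf /merel /= dinf_sym. Qed.

Lemma Einf_trans x y z : Einf x y -> Einf y z -> Einf x z.
Proof.
by move=> xy yz; apply: le_lt_trans (dinf_triangle x y z) _; exact: lte_add_pinfty.
Qed.

Let truncate_continuous x y (B : R) :
  continuous (fun r => x r + Num.max (- B) (Num.min B (y r - x r))).
Proof.
move=> r; apply: cvgD; first exact: cts_CR.
have cyx : {for r, continuous (fun r => y r - x r : R^o)} by apply: cvgB; exact: cts_CR.
have cB (c : R) : {for r, continuous (fun=> c : R^o)} by exact: cvg_cst.
exact: (continuous_max (cB _) (continuous_min (cB _) cyx)).
Qed.

(** [y] clamped to the band of half-width [B] around [x]: a member of the class of [x] that agrees
    with [y] on a given compact interval once [B] is large. *)
Definition truncate x y (B : R) : CR R := CR_of (@truncate_continuous x y B).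

Lemma truncateE x y B r :
  truncate x y B r = x r + Num.max (- B) (Num.min B (y r - x r)).
Proof. by []. Qed.

Lemma truncate_le x y B r : 0 <= B -> `|truncate x y B r - x r| <= B.
Proof.
move=> B0; rewrite truncateE addrC addKr ler_norml.
have BB : - B <= B by lra.
by rewrite le_max lexx /= ge_max BB ge_min lexx.
Qed.

Lemma truncate_id x y B r : `|y r - x r| <= B -> truncate x y B r = y r.
Proof.
rewrite ler_norml => /andP[yB By].
by rewrite truncateE (min_r By) (max_r yB) addrC subrK.
Qed.

Lemma truncate_agree x y m : exists2 B : R, 0 < B &
  forall r : R, `|r| <= m%:R -> truncate x y B r = y r.
Proof.
have [B B0 xB] := CR_bounded_itv x m; have [C C0 yC] := CR_bounded_itv y m.
exists (C + B) => [|r rm]; first exact: addr_gt0.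
apply: truncate_id; rewrite (le_trans (ler_normB _ _))// lerD//; [exact: yC|exact: xB].
Qed.

Lemma dense_truncate x (O : set (CR R)) : open O -> O !=set0 ->
  exists y (B : R), O y /\ forall r, `|y r - x r| <= B.
Proof.
move=> oO [y Oy]; have [m [d d0 dO]] := nbhsCR (open_nbhs_nbhs (conj oO Oy)).
have [B B0 Bm] := truncate_agree x y m.
exists (truncate x y B), B; split; last by move=> r; apply: truncate_le; exact: ltW.
by apply: dO => r rm; rewrite Bm// subrr normr0 ltW.
Qed.

(** Equal subdivision of the straight segment: tubes are convex, and more than [B / e] pieces make
    each step uniformly small. *)
Lemma CR_segment x y m (d e B : R) : 0 < e -> (forall r, `|y r - x r| <= B) ->
  tube x m d y -> exists K (z : nat -> CR R), [/\ z 0%N = x, z K = y,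
    forall i, (i <= K)%N -> tube x m d (z i) & forall i r, `|z i.+1 r - z i r| <= e].
Proof.
move=> e0 xyB xy; pose K := (Num.truncn (B / e)).+1.
have K0 : 0 < K%:R :> R by [].
have cz (i : nat) : continuous (fun r => x r + i%:R / K%:R * (y r - x r)).
  move=> r; apply: cvgD; first exact: cts_CR.
  by apply: cvgM; [exact: cvg_cst | apply: cvgB; exact: cts_CR].
pose z i : CR R := CR_of (cz i).
have zE i r : z i r = x r + i%:R / K%:R * (y r - x r) by [].
exists K, z; split.
- by apply/continuousEP => r; rewrite zE mul0r mul0r addr0.
- by apply/continuousEP => r; rewrite zE divff ?gt_eqF// mul1r addrC subrK.
- move=> i iK r rm; rewrite zE addrC addKr normrM ger0_norm ?divr_ge0//.
  rewrite -[leRHS]mul1r ler_pM ?divr_ge0// ?xy//.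
  by rewrite ler_pdivrMr// mul1r ler_nat.
move=> i r; rewrite !zE opprD addrACA subrr add0r -mulrBl -mulrBl -natrB// subSnn.
rewrite mul1r normrM ger0_norm ?invr_ge0// mulrC ler_pdivrMr//.
by rewrite (le_trans (xyB r))// mulrC -ler_pdivrMr// ltW// truncnS_gt.
Qed.

Let move_continuous (e : R) x a b :
  continuous (fun r => x r + e * (squash (b r) - squash (a r))).
Proof.
move=> r; apply: cvgD; first exact: cts_CR.
apply: cvgM; first exact: cvg_cst.
by apply: cvgB; apply: continuous_comp; (exact: cts_CR || exact: continuous_squash).
Qed.

(* Bounded perturbations of x, with the parameter ranging over the Baire space
   C(R) itself: this replaces the action of a separable group of bounded
   functions. *)
Definition mv (e : R) x a b : CR R := CR_of (@move_continuous e x a b).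

Definition CR0 : CR R := CR_of (@cst_continuous R R 0).

Lemma mvE e x a b r : mv e x a b r = x r + e * (squash (b r) - squash (a r)).
Proof. by []. Qed.

Lemma mv_id e x a : mv e x a a = x.
Proof. by apply/continuousEP => r; rewrite mvE subrr mulr0 addr0. Qed.

(** Moves compose through their parameters; with [mv_id], the move from [b] to [a] undoes the one
    from [a] to [b]. This provides the sections for [residual_preimage]. *)
Lemma mv_mv e x a b c : mv e (mv e x a b) b c = mv e x a c.
Proof. by apply/continuousEP => r; rewrite !mvE; ring. Qed.

Lemma mv_bound e x a b r : `|mv e x a b r - x r| <= `|e| * 2.
Proof.
rewrite mvE addrC addKr normrM ler_wpM2l// (le_trans (ler_normB _ _))//.
by have := squash_lt1 (a r); have := squash_lt1 (b r); lra.
Qed.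

Lemma Einf_mv e x a b : Einf x (mv e x a b).
Proof. by apply/Einf_sym/Einf_bounded => r; exact: mv_bound. Qed.

Lemma mv_continuous (e : R) (T : topologicalType) (x a b : T -> CR R) :
  continuous x -> continuous a -> continuous b ->
  continuous (fun t => mv e (x t) (a t) (b t)).
Proof.
move=> cx ca cb; apply: continuous_to_CR => t m d d0.
pose q := d / (1 + 4 * `|e|).
have e0 : 0 < 1 + 4 * `|e| by rewrite ltr_pwDl// mulr_ge0.
have q0 : 0 < q by rewrite divr_gt0.
have xq : nbhs t [set s | tube (x t) m q (x s)] := cx t _ (nbhs_tube _ m q0).
have aq : nbhs t [set s | tube (a t) m q (a s)] := ca t _ (nbhs_tube _ m q0).
have bq : nbhs t [set s | tube (b t) m q (b s)] := cb t _ (nbhs_tube _ m q0).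
apply: filterS (filterI xq (filterI aq bq)) => s [/= xs [as_ bs]] r rm.
rewrite !mvE.
have -> : x s r + e * (squash (b s r) - squash (a s r)) -
    (x t r + e * (squash (b t r) - squash (a t r))) = (x s r - x t r) +
    e * ((squash (b s r) - squash (b t r)) - (squash (a s r) - squash (a t r))) by ring.
have -> : d = q + `|e| * (2 * q + 2 * q) by rewrite /q; field; rewrite gt_eqF.
rewrite (le_trans (ler_normD _ _))// lerD ?xs// normrM ler_wpM2l//.
rewrite (le_trans (ler_normB _ _))// lerD// (le_trans (squash_lip _ _))// ler_pM2l//.
  exact: bs.
exact: as_.
Qed.

End Moves.

(** * Generic points *)

Lemma continuous_fst (S T : topologicalType) : continuous (@fst S T).
Proof. by move=> p; exact: cvg_fst. Qed.

Lemma continuous_snd (S T : topologicalType) : continuous (@snd S T).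
Proof. by move=> p; exact: cvg_snd. Qed.

Lemma continuous_pair (S T U : topologicalType) (f : S -> T) (g : S -> U) :
  continuous f -> continuous g -> continuous (fun x => (f x, g x)).
Proof. by move=> cf cg x; apply: cvg_pair; [exact: cf | exact: cg]. Qed.

Lemma continuous_idfun (S : topologicalType) : continuous (fun x : S => x).
Proof. by move=> x; exact: cvg_id. Qed.

Lemma continuous_divg (G : topologicalGroupType) :
  continuous (fun gh : G * G => (gh.1 * gh.2^-1)%g).
Proof.
move=> gh; apply: (@continuous_comp _ _ _ (fun gh : G * G => (gh.1, (gh.2^-1)%g))
  (fun gh : G * G => (gh.1 * gh.2)%g)); last exact: mulg_continuous.
apply: continuous_pair; first exact: continuous_fst.
by move=> p; apply: (@continuous_comp _ _ _ snd (fun g : G => (g^-1)%g));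
  [exact: cvg_snd | exact: invg_continuous].
Qed.

Section MoveMaps.
Context {R : realType}.
Notation X := (CR R).

Lemma CR2_second_countable : @second_countable (X * X)%type.
Proof. by apply: second_countable_prod; exact: CR_second_countable. Qed.

Lemma CR2_Baire_space : Baire_space (X * X)%type.
Proof.
apply: Baire_space_prod; first exact: CR_second_countable.
  exact: CR_Baire_space.
exact: CR_Baire_space.
Qed.

Lemma continuous_mv2 (e : R) (x : X) : continuous (fun ab : X * X => mv e x ab.1 ab.2).
Proof.
by apply: mv_continuous;
  [exact: cst_continuous | exact: continuous_fst | exact: continuous_snd].
Qed.

Lemma continuous_mv1 (e : R) (x b : X) : continuous (fun ab : X * X => mv e x ab.1 b).
Proof.
by apply: mv_continuous;
  [exact: cst_continuous | exact: continuous_fst | exact: cst_continuous].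
Qed.

(** For fixed parameters a move is undone by the opposite move, so residual sets pull back to
    triples [(x, (a, b))]; Kuratowski-Ulam then separates [x] from the parameters. *)
Lemma residual_mv (e : R) (A : set X) : residual A ->
  residual [set x | residual [set ab : X * X | A (mv e x ab.1 ab.2)]].
Proof.
move=> rA; apply: (@residual_prod _ _ [set p : X * (X * X) | A (mv e p.1 p.2.1 p.2.2)]).
  exact: CR2_second_countable.
apply: (@residual_preimage _ _ (fun p : X * (X * X) => mv e p.1 p.2.1 p.2.2)) => //.
  apply: mv_continuous; first exact: continuous_fst.
    by move=> p; apply: continuous_comp; [exact: continuous_snd | exact: continuous_fst].
  by move=> p; apply: continuous_comp; exact: continuous_snd.
move=> [x [a b]]; exists (fun z => (mv e z b a, (a, b))).
  apply: continuous_pair; last exact: cst_continuous.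
  by apply: mv_continuous; (exact: cst_continuous || exact: continuous_idfun).
by split; [rewrite /= mv_mv mv_id | move=> z; rewrite /= mv_mv mv_id].
Qed.

Lemma residual_invariant (A : set X) : residual A ->
  exists2 Z : set X, residual Z /\ Z `<=` A &
    forall x (e : nat), Z x -> residual [set ab : X * X | Z (mv e%:R x ab.1 ab.2)].
Proof.
move=> rA.
(* Each [A_ k.+1] keeps the points whose generic moves stay in [A_ k], so the intersection over [k]
   is stable under generic moves. *)
pose A_ := fix A_ (k : nat) := if k is k'.+1 then A_ k' `&` \bigcap_(e : nat)
  [set x | residual [set ab : X * X | A_ k' (mv e%:R x ab.1 ab.2)]] else A.
have rA_ k : residual (A_ k).
  elim: k => //= k IHk; apply: residualI => //.
  by apply: residual_bigcap => e; exact: residual_mv.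
exists (\bigcap_k A_ k); first split.
- exact: (residual_bigcap rA_).
- by move=> x /(_ 0%N I).
move=> x e Zx; have := residual_bigcap (fun k => (Zx k.+1 I).2 e I).
by apply: residual_sub => ab abA k _; exact: abA.
Qed.

End MoveMaps.

Section GenericPoints.
Context {R : realType} {G : topologicalGroupType} {Y : topologicalType}.
Variables (act : continuous_action G Y) (c : complete_base G) (f : CR R -> Y).
Variable V : (set (CR R))^nat.
Hypothesis hY : hausdorff_space Y.
Hypothesis f_inv : invariant_map (@Einf R) (orbit_relation act) f.
Hypothesis odV : forall n, open (V n) /\ dense (V n).
Hypothesis fV : forall x N, (\bigcap_n V n) x -> nbhs (f x) N ->
  nbhs x [set x' | (\bigcap_n V n) x' -> N (f x')].

Notation X := (CR R).
Notation C := (\bigcap_n V n).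

Definition linked (W : set G) (x x' : X) := exists2 w, W w & f x' = act w (f x).

(** [mv e x ab.1 CR0] is the base point [z] for which [mv e z CR0] sends [ab.1] to [x] and [ab.2] to
    [mv e x ab.1 ab.2]. The condition thus compares two points with parameters in [O] over a common
    base point in [N]. *)
Definition locally_linked (e : R) (W : set G) (N O : set X) x :=
  residual [set ab : X * X | N (mv e x ab.1 (CR0 : X)) -> O ab.1 -> O ab.2 ->
    linked W x (mv e x ab.1 ab.2)].

Let rC : residual C.
Proof.
apply: residual_bigcap => n.
by apply: open_dense_residual; [exact: (odV n).1 | exact: (odV n).2].
Qed.

Let orbit_point (e : R) (xh : X * X) : X := mv e xh.1 CR0 xh.2.

Let continuous_orbit_point e : continuous (orbit_point e).
Proof.
apply: mv_continuous; [exact: continuous_fst | exact: cst_continuous | exact: continuous_snd].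
Qed.

Let residual_C2 e : residual [set xh : X * X | C xh.1 /\ C (orbit_point e xh)].
Proof.
apply: residualI.
  apply: (@residual_preimage _ _ (@fst X X)) => //; first exact: continuous_fst.
  move=> [x h]; exists (fun z => (z, h)) => //.
  by apply: continuous_pair; [exact: continuous_idfun | exact: cst_continuous].
apply: (@residual_preimage _ _ (orbit_point e)) => //.
move=> [x h]; exists (fun z => (mv e z h CR0, h)).
  apply: continuous_pair; last exact: cst_continuous.
  by apply: mv_continuous; (exact: cst_continuous || exact: continuous_idfun).
rewrite /orbit_point.
by split; [rewrite /= mv_mv mv_id | move=> z; rewrite /= mv_mv mv_id].
Qed.

Lemma continuous_act_r g : continuous (act g).
Proof.
move=> y; apply: (@continuous_comp _ _ _ (fun z : Y => (g, z))
  (fun gy : G * Y => act gy.1 gy.2)).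
  by apply: continuous_pair; [exact: cst_continuous | exact: continuous_idfun].
exact: act_continuous.
Qed.

(** Over the residual set where both points lie in [C], the condition on [w] is closed, since [f] is
    continuous there and [Y] is Hausdorff; hence [projection_Baire_property] applies. *)
Let linked_by_Baire e (W : set G) (g : G) : closed W ->
  Baire_property [set xh : X * X | (C xh.1 /\ C (orbit_point e xh)) /\
    exists2 w, W w & f (orbit_point e xh) = act w (act g (f xh.1))].
Proof.
move=> cW; pose S := [set xh : X * X | C xh.1 /\ C (orbit_point e xh)].
pose F := [set p : (X * X) * G | S p.1 /\
  (W p.2 /\ f (orbit_point e p.1) = act p.2 (act g (f p.1.1)))].
have -> : [set xh : X * X | (C xh.1 /\ C (orbit_point e xh)) /\
    exists2 w, W w & f (orbit_point e xh) = act w (act g (f xh.1))] =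
  [set xh | exists w, F (xh, w)].
  apply/seteqP; split=> xh [] => [Sx [w Ww fw]|w [Sx [Ww fw]]]; first by exists w.
  by split=> //; exists w.
apply: (projection_Baire_property c (@CR2_second_countable R) (residual_C2 e)).
move=> [x h] w [Cx Ch] clF; split=> //; split.
  apply: cW => N wN.
  have [|[xh w'] [[_ [Ww' _]] [_ Nw']]] := clF (setT `*` N).
    by exists (setT, N) => //; split => //; exact: filterT.
  by exists w'.
apply: hY => A B Ap Bq.
have nA : nbhs (x, h) [set xh | C (orbit_point e xh) -> A (f (orbit_point e xh))].
  exact: (continuous_orbit_point (fV Ch Ap)).
have [[P Q] /= [Pw Qx] PQ] := @act_continuous _ _ act (w, act g (f x)) B Bq.
have nQ : nbhs x [set x' | C x' -> Q (act g (f x'))].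
  by apply: (@fV _ (act g @^-1` Q)) => //; exact: continuous_act_r.
have [|[[x' h'] w'] [[[Cx' Ch'] [_ E]] [[/= A' Q'] P']]] := clF
  ([set xh | (C (orbit_point e xh) -> A (f (orbit_point e xh))) /\
     (C xh.1 -> Q (act g (f xh.1)))] `*` P).
  exists ([set xh | (C (orbit_point e xh) -> A (f (orbit_point e xh))) /\
     (C xh.1 -> Q (act g (f xh.1)))], P) => //; split => //.
  apply: filterI => //.
  exact: (@continuous_fst X X (x, h) _ nQ).
exists (f (orbit_point e (x', h'))); split; first exact: A'.
by rewrite E; apply: (PQ (w', _)); split => //; exact: Q'.
Qed.

(** One of the countably many sets [P i] is residual in a nonempty open box, because they cover
    generic pairs and have the Baire property. Two points over the same base point in that box are
    linked by a quotient of two small elements. *)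
Lemma ex_locally_linked (e : R) (W : set G) (N0 : set X) :
  nbhs (1%g : G) W -> open N0 -> N0 !=set0 ->
  exists N O x h, [/\ open N, open O, N x, O h & N0 (mv e x CR0 h)] /\
    residual [set x | locally_linked e W N O x].
Proof.
move=> W1 oN0 [z0 N0z0].
have [n nW] : exists n, forall g h, cb c n 1%g g -> cb c n 1%g h -> W (g * h^-1)%g.
  have : nbhs ((1%g, 1%g) : G * G) [set gh | W (gh.1 * gh.2^-1)%g].
    by apply: continuous_divg; rewrite /= invg1 mulg1.
  case=> -[A B] [/= A1 B1] AB; have [n nAB] := cb_small c (filterI A1 B1).
  by exists n => g h /nAB[Ag _] /nAB[_ Bh]; exact: (AB (g, h)).
have [D dD] := complete_base_dense c 1%g.
pose S := [set xh : X * X | C xh.1 /\ C (orbit_point e xh)].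
pose P i := [set xh : X * X | S xh /\
  exists2 w, cb c n 1%g w & f (orbit_point e xh) = act w (act (D i) (f xh.1))].
have /choice[U UP] : forall i, exists U, open U /\ residual [set xh | P i xh <-> U xh].
  move=> i; have /Baire_propertyP[U ? ?] : Baire_property (P i).
    by apply: linked_by_Baire; exact: cb_closed.
  by exists U.
have [||xh [N0xh [Sxh Pxh]]] := @CR2_Baire_space R _
    (residualI (residual_C2 e) (residual_bigcap (fun i => (UP i).2)))
    (orbit_point e @^-1` N0).
- by exists (z0, CR0); rewrite /preimage /orbit_point /= mv_id.
- by apply: open_comp => // ? _; exact: continuous_orbit_point.
(* The translates of [cb c n 1%g] by the dense sequence [D] cover [G]: [g * (D i)^-1] is small for
   some [i]. *)
have [i Uxh] : exists i, U i xh.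
  have [g gE] := f_inv (Einf_mv e xh.1 CR0 xh.2).
  have [i gi] : exists i, cb c n 1%g (g * (D i)^-1)%g.
    apply: (dD g [set d | cb c n 1%g (g * d^-1)%g]).
    apply: (@continuous_comp _ _ _ (fun d : G => (g, d))
      (fun gh : G * G => (gh.1 * gh.2^-1)%g)).
    - by apply: continuous_pair; [exact: cst_continuous | exact: continuous_idfun].
    - exact: continuous_divg.
    by rewrite /= mulgV; exact: cb_nbhs.
  exists i; apply/(Pxh i I); split => //; exists (g * (D i)^-1)%g => //.
  by rewrite -actM mulgVK gE.
have [[N O] /= [xN hO] NO] : nbhs xh (U i).
  by apply: open_nbhs_nbhs; split => //; exact: (UP i).1.
exists N°, O°, xh.1, xh.2; split; first by split => //; exact: open_interior.
(* The base point over which [x] has parameter [a], paired with [a] or with [b] according to [k]. *)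
pose p (k : X * X -> X) (t : X * (X * X)) : X * X := (mv e t.1 t.2.1 CR0, k t.2).
have rp k : continuous k -> (forall ab : X * X, exists2 s : X -> X * X, continuous s &
    s (k ab) = ab /\ cancel s k) ->
    residual (p k @^-1` [set xh | P i xh <-> U i xh]).
  move=> ck sk; apply: residual_preimage; [| |exact: (UP i).2].
    apply: continuous_pair.
      apply: mv_continuous; [exact: continuous_fst | | exact: cst_continuous].
      by move=> ?; apply: continuous_comp; [exact: continuous_snd | exact: continuous_fst].
    by move=> t; apply: continuous_comp; [exact: continuous_snd | exact: ck].
  move=> [x ab]; have [s cs [sab sK]] := sk ab.
  exists (fun xh => (mv e xh.1 CR0 (s xh.2).1, s xh.2)).
    apply: continuous_pair.
      apply: mv_continuous; [exact: continuous_fst | exact: cst_continuous | ].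
      move=> z; apply: continuous_comp; last exact: continuous_fst.
      by apply: continuous_comp; [exact: continuous_snd | exact: cs].
    by move=> z; apply: continuous_comp; [exact: continuous_snd | exact: cs].
  split; first by rewrite /p /= sab mv_mv mv_id.
  by move=> [y h]; rewrite /p /= mv_mv mv_id sK.
have r0 := rp fst (@continuous_fst _ _) _.
have r1 := rp snd (@continuous_snd _ _) _.
apply: residual_sub (residual_prod (@CR2_second_countable R) (residualI (r0 _) (r1 _))).
- move=> x0; apply: residual_sub => -[a b] /= [P0 P1] Na Oa Ob.
  have /P0[_ [w0 W0 /= E0]] : U i (p fst (x0, (a, b))).
    by apply: NO; split; exact: interior_subset.
  have /P1[_ [w1 W1' /= E1]] : U i (p snd (x0, (a, b))).
    by apply: NO; split; exact: interior_subset.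
  (* [w0 * D i] leads from the base point to [x] and [w1 * D i] to the moved point; the uncontrolled
     [D i] cancels. *)
  exists (w1 * w0^-1)%g; first exact: nW.
  move: E0 E1; rewrite /orbit_point /= !mv_mv mv_id => -> ->.
  by rewrite -[RHS]actM mulgVK.
- move=> [a b]; exists (fun h => (h, b)).
    by apply: continuous_pair; [exact: continuous_idfun | exact: cst_continuous].
  by [].
- move=> [a b]; exists (fun h => (a, h)).
    by apply: continuous_pair; [exact: cst_continuous | exact: continuous_idfun].
  by [].
Qed.

(** The box found for one [x] serves every [x1] in [Z], so perturbations can be repeated from new
    points. The bound on [k] keeps [squash k] uniformly away from 1 and -1, leaving room for small
    uniform steps. *)
Definition generic_set (W : nat -> set G) (Z : set X) :=
  forall x (e n : nat), Z x -> exists N O k (B : R),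
    [/\ [/\ open N, open O, N (mv e%:R x k CR0) & O k], forall r, `|k r| <= B &
     forall x1, Z x1 -> residual [set ab : X * X |
       N (mv e%:R x1 ab.1 CR0) -> O ab.1 -> O ab.2 ->
       Z (mv e%:R x1 ab.1 ab.2) /\ linked (W n) x1 (mv e%:R x1 ab.1 ab.2)]].

Lemma ex_generic_set : exists Z : set X, [/\ residual Z, Z `<=` C,
  generic_set (fun n => cb c n 1%g) Z & forall x (e : nat), Z x ->
    residual [set ab : X * X | Z (mv e%:R x ab.1 ab.2)]].
Proof.
have [B oB nB] := second_countable_seq (@CR_second_countable R).
(* Boxes come from a countable base, so that requiring [L] at all good indices is a countable set of
   residual conditions. *)
pose L e n i j := locally_linked e%:R (cb c n 1%g) (B i) (B j).
pose good e n i j := residual [set x | L e n i j x].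
pose D e n := [set x | exists i j k (b : R), [/\ good e n i j,
  B i (mv e%:R x k CR0), B j k & forall r, `|k r| <= b]].
have rD e n : residual (D e n).
  apply: open_dense_residual.
    rewrite openE => x [i [j [k [b [gd Bx Bk kb]]]]].
    have : nbhs x [set x | B i (mv e%:R x k CR0)].
      have : continuous (fun x : X => mv e%:R x k CR0).
        by apply: mv_continuous; (exact: cst_continuous || exact: continuous_idfun).
      by apply; apply: open_nbhs_nbhs.
    by apply: filterS => y By; exists i, j, k, b.
  move=> N0 N00 oN0.
  have [N [P [x [h [[oN oP Nx Ph N0x] gNP]]]]] :=
    ex_locally_linked e%:R (cb_nbhs c n 1%g) oN0 N00.
  have [i Bx BN] := nB _ _ (open_nbhs_nbhs (conj oN Nx)).
  have [j Bh BP] := nB _ _ (open_nbhs_nbhs (conj oP Ph)).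
  have cx : continuous (fun k : X => mv e%:R x CR0 k).
    by apply: mv_continuous; (exact: cst_continuous || exact: continuous_idfun).
  (* [h] is replaced by a bounded parameter in the same open set. *)
  have [||k [b [[Bk N0k] kb]]] :=
      @dense_truncate R CR0 (B j `&` [set k | N0 (mv e%:R x CR0 k)]).
  - by apply: openI => //; apply: open_comp => // ? _; exact: cx.
  - by exists h.
  exists (mv e%:R x CR0 k); split => //; exists i, j, k, b; split => //.
  - apply: residual_sub gNP => y; apply: residual_sub => ab yab Bi Ba Bb.
    by apply: yab; [exact: BN | exact: BP | exact: BP].
  - by rewrite mv_mv mv_id.
  - by move=> r; have := kb r; rewrite /CR0 /= subr0.
pose Z0 := C `&` ((\bigcap_(p : nat * nat) D p.1 p.2) `&`
  \bigcap_(p : nat * nat * (nat * nat)) [set x | good p.1.1 p.1.2 p.2.1 p.2.2 ->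
     L p.1.1 p.1.2 p.2.1 p.2.2 x]).
have rZ0 : residual Z0.
  apply: residualI => //; apply: residualI; first by apply: residual_bigcap => p; exact: rD.
  apply: residual_bigcap => p; have [gp|ngp] := pselect (good p.1.1 p.1.2 p.2.1 p.2.2).
    by apply: residual_sub gp => x Lx _.
  by apply: residual_sub residualT => x _ /ngp.
have [Z [rZ ZZ0] Zinv] := residual_invariant rZ0.
exists Z; split => // [x /ZZ0[]//|].
move=> x e n /ZZ0[_ [/(_ (e, n) I)[i [j [k [b [gd Bx Bk kb]]]]] _]].
exists (B i), (B j), k, b; split => // x1 Zx1.
have [_ [_ /(_ (e, n, (i, j)) I gd) Lx1]] := ZZ0 _ Zx1.
apply: residual_sub (residualI (Zinv x1 e Zx1) Lx1) => ab [Zab Lab] Na Oa Ob.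
by split => //; exact: Lab.
Qed.

End GenericPoints.

(** * Perturbing a generic point *)

Lemma Baire_space_nbhs (T : topologicalType) (A N : set T) (t : T) :
  Baire_space T -> residual A -> nbhs t N -> exists s, N s /\ A s.
Proof.
move=> bT /bT dA tN; have [||s [Ns As]] := dA N°.
- by exists t.
- exact: open_interior.
by exists s; split => //; exact: interior_subset.
Qed.

Section Bending.
Context {R : realType}.
Notation X := (CR R).

Lemma nbhs_eval (y : X) (r d : R) : 0 < d -> nbhs y [set z : X | `|z r - y r| <= d].
Proof.
move=> d0; apply: filterS (nbhs_tube y (Num.truncn `|r|).+1 d0) => z; apply.
by rewrite ltW// truncnS_gt.
Qed.

Lemma squashK (t : R) : unsquash (squash t) = t.
Proof.
have d0 : 0 < 1 + `|t| by rewrite ltr_pwDl.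
rewrite /unsquash norm_squash /squash; field.
by rewrite addrK oner_neq0 gt_eqF.
Qed.

Lemma squash_far (t : R) : exists s : R, 1 / 2 <= `|squash s - squash t|.
Proof.
have s1 : squash 1 = 1 / 2 :> R by rewrite /squash normr1.
have sN1 : squash (- 1) = - (1 / 2) :> R by rewrite /squash normrN normr1 mulNr.
have d0 : 0 < 1 + `|t| by rewrite ltr_pwDl.
have [t0|t0] := leP t 0.
  have st : squash t <= 0 by rewrite /squash mulr_le0_ge0// invr_ge0 ltW.
  exists 1; rewrite s1 ger0_norm; lra.
have st : 0 <= squash t by rewrite /squash divr_ge0// ltW.
exists (- 1); rewrite sN1 ler0_norm; lra.
Qed.

Let bend_continuous (k : X) (m : nat) (c : R) :
  continuous (fun r => k r + c * Num.max 0 (r - m%:R)).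
Proof.
move=> r; apply: cvgD; first exact: cts_CR.
apply: cvgM; first exact: cvg_cst.
have c0 : {for r, continuous (fun=> 0 : R^o)} by exact: cvg_cst.
have cm : {for r, continuous (fun r : R => r - m%:R : R^o)}.
  by apply: cvgB; [exact: cvg_id | exact: cvg_cst].
exact: (continuous_max c0 cm).
Qed.

Lemma CR_bend (k : X) (m : nat) (s : R) : exists2 h : X,
  forall r : R, `|r| <= m%:R -> h r = k r & h m.+1%:R = s.
Proof.
pose h := CR_of (@bend_continuous k m (s - k m.+1%:R)).
have hE r : h r = k r + (s - k m.+1%:R) * Num.max 0 (r - m%:R) by [].
exists h => [r rm|]; rewrite hE.
  by rewrite max_l ?mulr0 ?addr0// subr_le0 (le_trans (ler_norm _)).
rewrite max_r; last by rewrite subr_ge0 ler_nat.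
by rewrite -natrB// subSnn mulr1 addrC subrK.
Qed.

End Bending.

Section Dynamics.
Context {R : realType} {G : topologicalGroupType} {Y : topologicalType}.
Variables (act : continuous_action G Y) (f : CR R -> Y) (W : nat -> set G).
Variable Z : set (CR R).
Hypothesis gZ : generic_set act f W Z.

Notation X := (CR R).

Lemma generic_jump x n (P : set X) (b : R) : Z x -> nbhs x P -> 0 <= b ->
  exists x', [/\ Z x', P x', linked act f (W n) x x', Einf x x' &
    exists r, b < `|x' r - x r|].
Proof.
(* Two values of [squash] at distance 1/2, scaled by an amplitude above [2 * b], are more than [b]
   apart. *)
move=> Zx /nbhs_interior xP b0; pose e := (Num.truncn (2 * b)).+1.
have eb : b < e%:R / 2 by rewrite ltr_pdivlMr// mulrC truncnS_gt.
have [N [Q [k [_ [[oN oQ Nk Qk] _ /(_ _ Zx) rab]]]]] := gZ e n Zx.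
have [m1 [d1 d10 Pd1]] := nbhsCR xP.
have [m2 [d2 d20 Qd2]] := nbhsCR (open_nbhs_nbhs (conj oQ Qk)).
(* [h] will equal [k] on the interval seen by [P] and [Q] and be bent at the next integer, so both
   neighbourhoods ignore the jump. *)
have [s sfar] := squash_far (k (maxn m1 m2).+1%:R).
have [h hk hs] := CR_bend k (maxn m1 m2) s.
have hkE (r : R) m : (m <= maxn m1 m2)%N -> `|r| <= m%:R -> h r = k r.
  by move=> mM rm; apply: hk; rewrite (le_trans rm)// ler_nat.
set r0 : R := (maxn m1 m2).+1%:R in sfar hs.
have Qh : Q h.
  by apply: Qd2 => r rm; rewrite (hkE _ m2)// ?leq_maxr// subrr normr0 ltW.
have Ph : P° (mv e%:R x k h).
  apply: Pd1 => r rm; rewrite mvE (hkE _ m1) ?leq_maxl//.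
  by rewrite subrr mulr0 addr0 subrr normr0 ltW.
have far : b < `|mv e%:R x k h r0 - x r0|.
  rewrite mvE addrC addKr hs normrM (lt_le_trans eb)// ger0_norm//.
  by rewrite ler_wpM2l//; rewrite mul1r in sfar.
have n1 : nbhs (k, h) [set ab : X * X | N (mv e%:R x ab.1 CR0)].
  by apply: (@continuous_mv1 _ _ _ CR0); apply: open_nbhs_nbhs.
have n2 : nbhs (k, h) [set ab : X * X | Q ab.1 /\ Q ab.2].
  by exists (Q, Q) => //; split; apply: open_nbhs_nbhs.
have n3 : nbhs (k, h) [set ab : X * X | P° (mv e%:R x ab.1 ab.2)].
  by apply: continuous_mv2; apply: open_nbhs_nbhs; split => //; exact: open_interior.
have n4 : nbhs (k, h) [set ab : X * X | b < `|mv e%:R x ab.1 ab.2 r0 - x r0|].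
  pose q := (`|mv e%:R x k h r0 - x r0| - b) / 2.
  have q0 : 0 < q by rewrite divr_gt0// subr_gt0.
  have : nbhs (k, h) [set ab : X * X |
      `|mv e%:R x ab.1 ab.2 r0 - mv e%:R x k h r0| <= q].
    exact: (@continuous_mv2 _ _ _ (k, h) _ (nbhs_eval _ r0 q0)).
  apply: filterS => ab /= abq.
  have := ler_distD (mv e%:R x ab.1 ab.2 r0) (mv e%:R x k h r0) (x r0).
  rewrite (distrC (mv e%:R x k h r0) (mv e%:R x ab.1 ab.2 r0)) => tri.
  by move: far abq; rewrite /q; lra.
(* All requirements are open in the pair [(k, h)], so a generic pair nearby meets them too. *)
have [[a c] [[N1 [[Qa Qc] [P1 far1]]] ab]] := Baire_space_nbhs CR2_Baire_space rab
  (filterI n1 (filterI n2 (filterI n3 n4))).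
have [Zac lac] := ab N1 Qa Qc.
exists (mv e%:R x a c); split => //; first exact: interior_subset.
  exact: Einf_mv.
by exists r0.
Qed.

Hypothesis inv_Z : forall x (e : nat), Z x ->
  residual [set ab : X * X | Z (mv e%:R x ab.1 ab.2)].

Let unsquash_path_continuous (u v w : X) (e c : R) (c1 : c < 1)
    (uvw : forall r, `|squash (u r) + (v r - w r) / e| <= c) :
  continuous (fun r => unsquash (squash (u r) + (v r - w r) / e)).
Proof.
move=> r; apply: (@continuous_comp _ _ _ (fun r => squash (u r) + (v r - w r) / e) unsquash).
  apply: cvgD; first by apply: continuous_comp; [exact: cts_CR | exact: continuous_squash].
  by apply: cvgM; [apply: cvgB; exact: cts_CR | exact: cvg_cst].
apply: cvgM; first exact: cvg_id.
apply: cvgV; last by apply: cvgB; [exact: cvg_cst | exact: norm_continuous].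
by rewrite gt_eqF// subr_gt0 (le_lt_trans (uvw r)).
Qed.

(** Solves for the last parameter: its [squash] must be [squash u + (v - x) / e], which has to stay
    uniformly inside the interval from -1 to 1. *)
Lemma mv_solve (x v u : X) (e c : R) : e != 0 -> c < 1 ->
  (forall r, `|squash (u r) + (v r - x r) / e| <= c) ->
  exists2 h : X, mv e x u h = v &
    forall r, h r = unsquash (squash (u r) + (v r - x r) / e).
Proof.
move=> e0 c1 uv; pose h := CR_of (@unsquash_path_continuous u v x e c c1 uv).
have hE r : h r = unsquash (squash (u r) + (v r - x r) / e) by [].
exists h => //; apply/continuousEP => r; rewrite mvE hE unsquashK.
  by field.
exact: le_lt_trans (uv r) c1.
Qed.

Lemma generic_class_dense x (p : X) (P : set X) : Z x -> nbhs p P ->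
  exists x', [/\ Z x', P x' & Einf x x'].
Proof.
move=> Zx /nbhsCR[m [d d0 dP]].
have [T T0 TE] := truncate_agree x p m.
(* Amplitude at least [2 * T] makes the required shift of [squash] at most 1/2, so [mv_solve]
   reaches the truncation exactly from [CR0]. *)
pose y := truncate x p T; pose e := (Num.truncn (2 * T)).+1.
have eT : 2 * T <= e%:R by rewrite ltW// truncnS_gt.
have e0 : 0 < e%:R :> R by [].
have [|||h mvh _] := @mv_solve x y CR0 e%:R (1 / 2).
- by rewrite gt_eqF.
- by lra.
- move=> r; rewrite squash0 add0r normrM normfV (gtr0_norm e0) ler_pdivrMr//.
  by have := truncate_le x p r (ltW T0); rewrite -/y; lra.
have n1 : nbhs (CR0, h) [set ab : X * X | tube y m d (mv e%:R x ab.1 ab.2)].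
  by apply: continuous_mv2; rewrite /= mvh; exact: nbhs_tube.
have [[a c] [/= yac Zac]] := Baire_space_nbhs CR2_Baire_space (inv_Z e Zx) n1.
exists (mv e%:R x a c); split => //; last exact: Einf_mv.
by apply: dP => r rm; rewrite -(TE r rm); exact: yac.
Qed.

Hypothesis W1 : forall n, W n 1%g.
Hypothesis WM : forall n g h, W n g -> W n h -> W n (g * h)%g.

Lemma linked_trans n x y z : linked act f (W n) x y -> linked act f (W n) y z ->
  linked act f (W n) x z.
Proof.
by move=> [w ww fy] [v vw fz]; exists (v * w)%g; [exact: WM | rewrite actM -fy].
Qed.

(* Small uniform steps inside a convex tube: the closure of the W n-class of x is
   stable under them, and they join x to a dense set of points of the tube. *)
Lemma linked_dense x n : Z x -> exists2 U, nbhs x U &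
  forall y P, U y -> nbhs y P -> exists x', [/\ Z x', P x' & linked act f (W n) x x'].
Proof.
move=> Zx; have [N [Q [k [B0 [[oN oQ Nk Qk] kB0 gab]]]]] := gZ 1%N n Zx.
pose B := Num.max B0 1.
have B1 : 1 <= B by rewrite le_max lexx orbT.
have kB r : `|k r| <= B by rewrite le_max kB0.
have [m1 [d1 d10 Nd1]] := nbhsCR (open_nbhs_nbhs (conj oN Nk)).
have [m2 [d2 d20 Qd2]] := nbhsCR (open_nbhs_nbhs (conj oQ Qk)).
pose m := maxn m1 m2.
(* The margin left by [|squash k| <= B / (1 + B)]. Half of it is spent on uniform steps, and [L] is
   the Lipschitz constant of [unsquash] on the rest. *)
pose rho := (1 + B)^-1.
have rho0 : 0 < rho by rewrite invr_gt0; lra.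
have sqk r : `|squash (k r)| <= 1 - rho.
  rewrite norm_squash (_ : 1 - rho = B / (1 + B)); last first.
    by rewrite /rho; field; rewrite gt_eqF//; lra.
  have k0 := normr_ge0 (k r); have := kB r.
  rewrite ler_pdivrMr; last by lra.
  rewrite mulrAC ler_pdivlMr; last by lra.
  by nra.
pose L := 3 / (1 - (1 - rho / 2)) ^+ 2.
have L0 : 0 < L by rewrite divr_gt0// exprn_gt0//; lra.
(* Base points shift by at most [2 * dl], which must stay in [N]; displacements are at most
   [3 * dl], and [L] times that must keep the parameter in [Q]. *)
pose dl := Num.min (d1 / 2) (d2 / (3 * L)).
have dl0 : 0 < dl by rewrite lt_min !divr_gt0// mulr_gt0.
have dld1 : 2 * dl <= d1.
  by have : dl <= d1 / 2 by [rewrite /dl ge_min lexx]; lra.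
have dld2 : L * (3 * dl) <= d2.
  have -> : L * (3 * dl) = dl * (3 * L) by rewrite mulrCA mulrA mulrC mulrA.
  have : dl <= d2 / (3 * L) by rewrite /dl ge_min lexx orbT.
  by rewrite ler_pdivlMr// mulr_gt0.
(* Half of [rho / 2]: one [eta] for the step from [z] to [z'], one for approximating [z] by a linked
   point. *)
pose eta := rho / 4.
have eta0 : 0 < eta by rewrite divr_gt0.
pose F (z : X) := forall P, nbhs z P -> exists x', [/\ Z x', P x' & linked act f (W n) x x'].
have stepF (z z' : X) : F z -> tube x m dl z -> tube x m dl z' ->
    (forall r, `|z' r - z r| <= eta) -> F z'.
  move=> Fz zx z'x zz' P /nbhsCR[p [d d0 dP]].
  pose t := Num.min eta dl.
  have t0 : 0 < t by rewrite lt_min eta0.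
  have teta : t <= eta by rewrite ge_min lexx.
  have tdl : t <= dl by rewrite ge_min lexx orbT.
  have [x1 [Zx1 zx1 lx1]] := Fz _ (nbhs_tube z (maxn m p) t0).
  (* [x1] approximates [z] only on a compact interval; truncation keeps [z'] there and makes the
     move from [x1] uniformly small everywhere. *)
  pose y := truncate x1 z' (rho / 2).
  have yx1 r : `|y r - x1 r| <= rho / 2 by apply: truncate_le; rewrite divr_ge0// ltW.
  have yE (r : R) : `|r| <= (maxn m p)%:R -> y r = z' r.
    move=> rm; apply: truncate_id; rewrite -(subrKA (z r)) (le_trans (ler_normD _ _))//.
    rewrite (_ : rho / 2 = eta + eta); last by rewrite /eta; field.
    by rewrite lerD// distrC (le_trans (zx1 _ rm)).
  have mp (r : R) : `|r| <= m%:R -> `|r| <= (maxn m p)%:R.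
    by move=> rm; rewrite (le_trans rm)// ler_nat leq_maxl.
  have x1x (r : R) : `|r| <= m%:R -> `|x1 r - x r| <= 2 * dl.
    move=> rm; have := ler_distD (z r) (x1 r) (x r).
    by have := zx r rm; have := zx1 r (mp _ rm); lra.
  have z'x1 (r : R) : `|r| <= m%:R -> `|z' r - x1 r| <= 3 * dl.
    move=> rm; have := ler_distD (x r) (z' r) (x1 r); rewrite (distrC (x r) (x1 r)).
    by have := z'x r rm; have := x1x r rm; lra.
  have c1 : 1 - rho / 2 < 1 by lra.
  have sqky r : `|squash (k r) + (y r - x1 r) / 1| <= 1 - rho / 2.
    rewrite divr1.
    have := ler_normD (squash (k r)) (y r - x1 r).
    by have := sqk r; have := yx1 r; lra.
  have [h mvh hE] := mv_solve (oner_neq0 R) c1 sqky.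
  have Qh : Q h.
    apply: Qd2 => r rm2; have rm : `|r| <= m%:R.
      by rewrite (le_trans rm2)// ler_nat leq_maxr.
    rewrite hE -{2}(squashK (k r)).
    apply: le_trans (unsquash_lip c1 (sqky r) _) _.
      by apply: le_trans (sqk r) _; lra.
    have -> : squash (k r) + (y r - x1 r) / 1 - squash (k r) = y r - x1 r by field.
    rewrite (yE _ (mp _ rm)); apply: le_trans dld2.
    by apply: ler_wpM2l; [exact: ltW | exact: z'x1].
  have N1 : N (mv 1 x1 k CR0).
    apply: Nd1 => r rm1; have rm : `|r| <= m%:R.
      by rewrite (le_trans rm1)// ler_nat leq_maxl.
    rewrite !mvE opprD addrACA subrr addr0.
    by apply: le_trans dld1; exact: x1x.
  have n1 : nbhs (k, h) [set ab : X * X | N (mv 1 x1 ab.1 CR0)].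
    by apply: (@continuous_mv1 _ _ _ CR0); apply: open_nbhs_nbhs.
  have n2 : nbhs (k, h) [set ab : X * X | Q ab.1 /\ Q ab.2].
    by exists (Q, Q) => //; split; apply: open_nbhs_nbhs.
  have n3 : nbhs (k, h) [set ab : X * X | tube y p d (mv 1 x1 ab.1 ab.2)].
    by apply: continuous_mv2; rewrite /= mvh; exact: nbhs_tube.
  have [[a c] [[N2 [[Qa Qc] yac]] ab]] := Baire_space_nbhs CR2_Baire_space (gab _ Zx1)
    (filterI n1 (filterI n2 n3)).
  have [Zac lac] := ab N2 Qa Qc.
  exists (mv 1 x1 a c); split => //; last exact: linked_trans lac.
  apply: dP => r rp; rewrite -(yE r) ?(yac r)//.
  by rewrite (le_trans rp)// ler_nat leq_maxr.
have Fx : F x.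
  by move=> P /nbhs_singleton Px; exists x; split => //; exists 1%g; rewrite ?act1.
exists (tube x m dl); first exact: nbhs_tube.
(* A point of the tube may be at infinite distance from [x]; its truncation is not, and agrees with
   it where [P0] looks. *)
move=> y0 P0 y0x /nbhsCR[p [d d0 dP]].
have [T T0 TE] := truncate_agree x y0 (maxn m p).
pose y := truncate x y0 T.
have yx : tube x m dl y.
  by move=> r rm; rewrite /y TE ?y0x// (le_trans rm)// ler_nat leq_maxl.
suff Fy : F y.
  apply: Fy; apply: filterS (nbhs_tube y p d0) => z yz; apply: dP => r rp.
  by rewrite -(TE r) ?(yz r)// (le_trans rp)// ler_nat leq_maxr.
have [K [path [path0 pathK path_tube path_step]]] :=
  CR_segment eta0 (fun r => truncate_le x y0 r (ltW T0)) yx.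
suff : F (path K) by rewrite pathK.
have : (K <= K)%N by [].
elim: {1 3}K => [_|i IHi iK]; first by rewrite path0.
apply: (stepF (path i)); [exact/IHi/ltnW | exact/path_tube/ltnW | |].
  exact: path_tube.
exact: path_step.
Qed.

End Dynamics.

(** * Orbits of generic points *)

Section Conclusions.
Context {R : realType} {G : topologicalGroupType} {Y : topologicalType}.
Variables (act : continuous_action G Y) (c : complete_base G) (f : CR R -> Y).
Variable V : (set (CR R))^nat.
Hypothesis hY : hausdorff_space Y.
Hypothesis f_inv : invariant_map (@Einf R) (orbit_relation act) f.
Hypothesis odV : forall n, open (V n) /\ dense (V n).
Hypothesis fV : forall x N, (\bigcap_n V n) x -> nbhs (f x) N ->
  nbhs x [set x' | (\bigcap_n V n) x' -> N (f x')].

Notation X := (CR R).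
Notation C := (\bigcap_n V n).

Lemma orbit_limit (x : X^nat) (s : G^nat) (z : X) (g : G) (y : Y) :
  C z -> (forall n, C (x n)) -> x @ \oo --> z -> s @ \oo --> g ->
  (forall n, f (x n) = act (s n) y) -> f z = act g y.
Proof.
move=> Cz Cx xz sg fx; apply: (@cvg_unique _ hY ((fun n => f (x n)) @ \oo)).
  by move=> N /(fV Cz)/xz[n0 _ nP]; exists n0 => // n /nP; apply; exact: Cx.
have -> : (fun n => f (x n)) = (fun n => act (s n) y) by apply/funext.
have ca : continuous (fun g => act g y).
  move=> h; apply: (@continuous_comp _ _ _ (fun g : G => (g, y))
    (fun gy : G * Y => act gy.1 gy.2)); last exact: act_continuous.
  by apply: continuous_pair; [exact: continuous_idfun | exact: cst_continuous].
exact: (cvg_comp _ _ sg (ca g)).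
Qed.

(** A left factor close to 1 is a small step from [s] in the sense of [cb_complete]. *)
Lemma cb_translate n (s : G) : exists k, forall w, cb c k 1%g w -> cb c n s (w * s)%g.
Proof.
have : nbhs (1%g : G) [set w | cb c n s (w * s)%g].
  apply: (@continuous_comp _ _ _ (fun w : G => (w, s)) (fun gh : G * G => (gh.1 * gh.2)%g)).
  - by apply: continuous_pair; [exact: continuous_idfun | exact: cst_continuous].
  - exact: mulg_continuous.
  by rewrite /= mul1g; exact: cb_nbhs.
by move=> /(cb_small c)[k]; exists k.
Qed.

Lemma orbit_relation_not_Einf :
  ~ forall x x', orbit_relation act (f x) (f x') -> Einf x x'.
Proof.
move=> fE.
have [Z [rZ ZC gZ _]] := ex_generic_set c hY f_inv odV fV.
have [x0 [_ Zx0]] := Baire_space_nbhs (@CR_Baire_space R) rZ (@filterT _ (nbhs CR0) _).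
pose P (n : nat) (u : X * G * set X) := [/\ Z u.1.1, f u.1.1 = act u.1.2 (f x0),
  Einf x0 u.1.1 & nbhs u.1.1 u.2].
(* The new neighbourhood carries a coordinate [r] at which all its members are more than [n] away
   from [x0], so the gap survives in the limit. *)
pose Q (n : nat) (u u' : X * G * set X) := cb c n u.1.2 u'.1.2 /\
  ((exists r, forall z, u'.2 z -> n%:R < `|z r - x0 r|) /\
  exists m (d : R), [/\ (n <= m)%N, 0 < d, d <= n.+1%:R^-1,
    u'.2 `<=` tube u.1.1 m d & tube u.1.1 m d `<=` u.2 `&` V n]).
have [||u [_ uPQ]] := @dependent_choice_nat _ P Q (x0, 1%g, setT).
- split => //=; [by rewrite act1 | | exact: filterT].
  by apply: (@Einf_bounded _ _ _ 0) => r; rewrite subrr normr0.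
- move=> n [[x g] N] [/= Zx fx x0x xN].
  have xNV : nbhs x (N `&` V n).
    apply: filterI => //; apply: open_nbhs_nbhs; split; [exact: (odV n).1 | exact: ZC].
  have [m [d d0 [nm dn dNV]]] := small_tube n xNV.
  have [k kP] := cb_translate n g.
  have [B BP] := Einf_bound x0x.
  (* [|B|] absorbs the distance from [x0] to [x], and 1 the width of the new neighbourhood at
     [r]. *)
  have b0 : 0 <= n%:R + 1 + `|B| by rewrite !addr_ge0.
  have [x' [Zx' tx' [w ww fx'] xx' [r xr]]] := generic_jump gZ k Zx
    (nbhs_interior (nbhs_tube x m d0)) b0.
  exists (x', (w * g)%g, tube x m d `&` [set z | `|z r - x' r| <= 1]); split.
    split=> //=; [by rewrite fx' fx -actM | exact: Einf_trans xx' |].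
    by apply: filterI => //; apply: nbhs_eval.
  split=> /=; first exact: kP.
  split; last by exists m, d; split => //; move=> z [].
  exists r => z [_ /= zr].
  have t1 := ler_distD (z r) (x' r) (x r).
  have t2 := ler_distD (x0 r) (z r) (x r).
  have := BP r; have := ler_norm B; rewrite (distrC (x' r) (z r)) in t1.
  by lra.
have /all_and2[uP /all_and2[uc /all_and2[ur /choice[m /choice[d md]]]]] := uPQ.
have uS n j : (n < j)%N -> (u j).2 `<=` (u n.+1).2.
  elim: j => // j IHj; rewrite ltnS leq_eqVlt => /predU1P[->//|/IHj jn].
  by apply: subset_trans jn => y uy; have [_ _ _ ut tu] := md j; have [] := tu _ (ut _ uy).
have [||n j|z [xz zt]] := @tube_limit _ (fun n => (u n).1.1) m d.
- by move=> n; have [] := md n.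
- by move=> n; have [] := md n.
- rewrite leq_eqVlt => /predU1P[->|nj]; have [_ dn0 _ ut _] := md n.
    by have [_ ? _ _ _] := md j; exact: tube_refl.
  by apply: ut; apply: (uS n j nj); have [_ _ _] := uP j; exact: nbhs_singleton.
have [g ug] := cb_complete uc.
have Cz : C z by move=> n _; have [_ _ _ _ /(_ _ (zt n))[]] := md n.
have fz : f z = act g (f x0).
  apply: (@orbit_limit (fun n => (u n).1.1) (fun n => (u n).1.2)) => //.
    by move=> n; apply: ZC; have [] := uP n.
  by move=> n; have [] := uP n.
have [B BP] : exists B : R, forall r, `|z r - x0 r| <= B.
  by apply/Einf_bound/Einf_sym/fE; exists g.
pose n := (Num.truncn `|B|).+1; have [r rP] := ur n.
have zP : (u n.+1).2 z by have [_ _ _ _ /(_ _ (zt n.+1))[]] := md n.+1.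
have := rP z zP; rewrite /n; have := truncnS_gt `|B|.
by have := BP r; have := ler_norm B; lra.
Qed.

Hypothesis W1 : forall n, cb c n 1%g 1%g.
Hypothesis WM : forall n g h, cb c n 1%g g -> cb c n 1%g h -> cb c n 1%g (g * h)%g.

Lemma generic_orbit_relation : exists2 Z : set X, residual Z &
  forall x y, Z x -> Z y -> orbit_relation act (f x) (f y).
Proof.
have [Z [rZ ZC gZ iZ]] := ex_generic_set c hY f_inv odV fV.
exists Z => // x0 y0 Zx0 Zy0.
pose W n := cb c n 1%g.
(* Near each point of [N] there are generic points whose image comes from [f a] by an element
   [cb]-close to [s]: a move of one side into [N] can be answered by the other. *)
pose reach (n : nat) (a : X) (s : G) (N : set X) := forall z P, N z -> nbhs z P ->
  exists x' s', [/\ Z x', P x', f x' = act s' (f a) & cb c n s s'].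
have reachP a x n s : Z x -> f x = act s (f a) -> exists2 U, nbhs x U & reach n a s U.
  move=> Zx fx; have [k kP] := cb_translate n s.
  have [U xU UP] := linked_dense gZ W1 WM k Zx; exists U => // z P Uz zP.
  have [x' [Zx' Px' [w ww fx']]] := UP z P Uz zP.
  by exists x', (w * s)%g; split => //; [rewrite fx' fx actM | exact: kP].
(* The [x] side is to move: [u.2] is a neighbourhood of the current [y] point within its reach. *)
pose P (n : nat) (u : (X * X) * (G * G) * set X) :=
  [/\ Z u.1.1.1 /\ Z u.1.1.2, f u.1.1.1 = act u.1.2.1 (f x0), f u.1.1.2 = act u.1.2.2 (f y0),
    nbhs u.1.1.2 u.2 & reach n x0 u.1.2.1 u.2].
pose Q (n : nat) (u u' : (X * X) * (G * G) * set X) :=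
  [/\ cb c n u.1.2.1 u'.1.2.1, cb c n u.1.2.2 u'.1.2.2 &
    exists m (d : R), [/\ (n <= m)%N, 0 < d /\ d <= n.+1%:R^-1,
      tube u.1.1.2 m d u'.1.1.1, u'.2 `<=` tube u.1.1.2 m d &
      tube u.1.1.2 m d `<=` u.2 `&` V n]].
have [U0 x0U0 U0P] : exists2 U, nbhs x0 U & reach 0%N x0 1%g U.
  by apply: reachP => //; rewrite act1.
(* [y0] first enters the region reachable from [x0]; [t0] may be large, since only later steps have
   to be small. *)
have [y1 [Zy1 U0y1 y01]] := generic_class_dense iZ Zy0 (nbhs_interior x0U0).
have [t0 ft0] := f_inv y01.
have [||u [_ uPQ]] := @dependent_choice_nat _ P Q (x0, y1, (1%g, t0), U0°).
- split => //=; first by rewrite act1.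
    by apply: open_nbhs_nbhs; split => //; exact: open_interior.
  by move=> z N /interior_subset; exact: U0P.
- move=> n [[[x y] [s t]] N] [/= [Zx Zy] fx fy yN rN].
  have yNV : nbhs y (N `&` V n).
    apply: filterI => //; apply: open_nbhs_nbhs; split; [exact: (odV n).1 | exact: ZC].
  have [m [d d0 [nm dn dNV]]] := small_tube n yNV.
  have [U yU UP] := reachP y0 y n t Zy fy.
  have yT : nbhs y (U `&` tube y m d)°.
    exact/nbhs_interior/filterI/nbhs_tube.
  have [x' [s' [Zx' Tx' fx' ss']]] := rN y _ (nbhs_singleton yN) yT.
  have [U' x'U' U'P] := reachP x0 x' n.+1 s' Zx' fx'.
  have x'T : nbhs x' (U `&` tube y m d).
    apply: filterS (open_nbhs_nbhs (conj (@open_interior _ _) Tx')).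
    exact: interior_subset.
  have x'T' : nbhs x' (U' `&` (U `&` tube y m d))° by exact/nbhs_interior/filterI.
  have [y' [t' [Zy' Ty' fy' tt']]] := UP x' _ (nbhs_singleton x'T).1 x'T'.
  exists (x', y', (s', t'), (U' `&` (U `&` tube y m d))°); split.
    split => //=; first by apply: open_nbhs_nbhs; split => //; exact: open_interior.
    by move=> z M /interior_subset[U'z _]; exact: U'P.
  split => //=; exists m, d; split => //.
    exact: (nbhs_singleton x'T).2.
  by move=> z /interior_subset[_ []].
have /all_and2[uP /all_and3[us ut /choice[m /choice[d md]]]] := uPQ.
have uS n j : (n < j)%N -> (u j).2 `<=` (u n.+1).2.
  elim: j => // j IHj; rewrite ltnS leq_eqVlt => /predU1P[->//|/IHj jn].
  by apply: subset_trans jn => y uy; have [_ _ _ uyt tu] := md j; have [] := tu _ (uyt _ uy).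
have [||n j|z [yz zt]] := @tube_limit _ (fun n => (u n).1.1.2) m d.
- by move=> n; have [] := md n.
- by move=> n; have [_ []] := md n.
- rewrite leq_eqVlt => /predU1P[->|nj]; first by have [_ [? _] _ _ _] := md j; exact: tube_refl.
  have [_ _ _ uyt _] := md n.
  by apply: uyt; apply: (uS n j nj); have [_ _ _] := uP j; move=> /nbhs_singleton.
have Cz : C z by move=> n _; have [_ _ _ _ /(_ _ (zt n))[]] := md n.
have [s us'] := cb_complete us; have [t ut'] := cb_complete ut.
have fzt : f z = act t (f y0).
  apply: (@orbit_limit (fun n => (u n).1.1.2) (fun n => (u n).1.2.2)) => //.
    by move=> n; apply: ZC; have [[]] := uP n.
  by move=> n; have [] := uP n.
have fzs : f z = act s (f x0).
  (* Shifted by one: the [x] point of stage [n.+1] lies in the tube around the [y] point of stage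
     [n]. *)
  apply: (@orbit_limit (fun n => (u n.+1).1.1.1) (fun n => (u n.+1).1.2.1)) => //.
  - by move=> n; apply: ZC; have [[]] := uP n.+1.
  - move=> N /nbhsCR[p [e e0 eN]].
    have [n pn ne] := ex_inv_nat p (divr_gt0 e0 (ltr0Sn _ 1)).
    exists n => // j /= nj; apply: eN => r rp.
    have [jm [_ dj] xj _ _] := md j.
    have rm : `|r| <= (m j)%:R.
      by rewrite (le_trans rp)// ler_nat (leq_trans pn)// (leq_trans nj).
    have de : d j <= e / 2.
      by rewrite (le_trans dj)// (le_trans _ ne)// lef_pV2 ?posrE// ler_nat ltnS.
    have := ler_distD ((u j).1.1.2 r) ((u j.+1).1.1.1 r) (z r).
    rewrite (distrC ((u j).1.1.2 r)).
    by have := xj r rm; have := zt j r rm; lra.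
  - by move=> N /us'[n0 _ nP]; exists n0 => // n /= nn; apply: (nP n.+1); exact: leqW.
  - by move=> n; have [] := uP n.+1.
exists (t^-1 * s)%g; rewrite actM -fzs fzt -actM mulVg.
by rewrite act1.
Qed.

End Conclusions.

(** * Polish spaces, S_oo, and turbulence *)

Section Polish.
Context {R : realType} {T : topologicalType}.
Hypothesis pT : polish R T.

Lemma polish_hausdorff : hausdorff_space T.
Proof.
have [_ [d [[d0 dC dT] dnbhs _]]] := pT => p q pq; apply: contrapT => npq.
have dge0 x y : 0 <= d x y.
  by have := dT x y x; rewrite (dC y) (d0 x x).2//; lra.
have dpq : 0 < d p q / 2.
  by rewrite divr_gt0// lt_def dge0 andbT; apply/eqP => /d0.
have nb z : nbhs z [set y | d z y < d p q / 2] by rewrite dnbhs; exists (d p q / 2).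
have [z [/= pz qz]] := pq _ _ (nb p) (nb q).
by have := dT p z q; rewrite (dC z q); lra.
Qed.

Lemma polish_second_countable : @second_countable T.
Proof.
have [[D cD dD] [d [[d0 dC dT] dnbhs _]]] := pT.
pose ball (x : T) (e : R) := [set y | d x y < e].
have nball x y e : d x y < e -> nbhs y (ball x e).
  move=> xy; rewrite dnbhs; exists (e - d x y); first by rewrite /= subr_gt0.
  by move=> z /= yz; rewrite /ball /=; have := dT x y z; lra.
pose F (p : T * nat) := (ball p.1 p.2.+1%:R^-1)°.
exists (F @` (D `*` setT)).
  by apply: sub_countable (card_image_le _ _) _; exact: countableX.
split; first by move=> _ [p _ <-]; exact: open_interior.
move=> x N; rewrite /= {1}dnbhs => -[e /= e0 eN].
have [k _ ke] := ex_inv_nat 0%N (divr_gt0 e0 (ltr0Sn _ 1)).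
have k0 : 0 < k.+1%:R^-1 :> R by rewrite invr_gt0.
have [||y [xy Dy]] := dD (ball x k.+1%:R^-1)°.
- by exists x; apply: nball; rewrite (d0 x x).2.
- exact: open_interior.
have {}xy := interior_subset xy.
exists (F (y, k)).
  split; first by exists (y, k).
  by apply: nball => /=; rewrite dC.
move=> z /interior_subset yz; apply: eN => /=; have := dT x y z.
move: xy yz ke; rewrite /ball /=; move: (k.+1%:R^-1) => q.
by lra.
Qed.

Lemma polish_complete_base : inhabited (complete_base T).
Proof.
have [[D cD dD] [d [[d0 dC dT] dnbhs dcomplete]]] := pT.
have [f finj] : exists f : T -> nat, {in D &, injective f}.
  by have /countable_injP[f finj] := cD; exists f => //; exact/inj_set.
have dxx x : d x x = 0 by exact/d0.
have dge0 x y : 0 <= d x y by have := dT x y x; rewrite (dC y) dxx; lra.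
(* Dyadic radii: a piece of stage [n] has radius [e n.+1] about a dense point, so two of its points
   are within [e n]. *)
pose e n : R := (2 ^+ n)^-1.
have e0 n : 0 < e n by rewrite invr_gt0 exprn_gt0.
have eS n : e n = e n.+1 + e n.+1.
  by rewrite /e exprS; field; rewrite expf_neq0.
have esmall (r : R) : 0 < r -> exists n, e n < r.
  move=> r0; exists (Num.truncn r^-1).+1.
  rewrite /e -[ltRHS]invrK ltf_pV2 ?posrE ?invr_gt0 ?exprn_gt0//.
  rewrite (lt_le_trans (truncnS_gt _))// -natrX ler_nat.
  exact/ltnW/ltn_expl.
pose c n s := [set t | d s t <= e n].
pose piece n k := [set t | exists y, [/\ D y, f y = k & d y t <= e n.+1]].
constructor; apply: (@Build_complete_base _ c piece).
- move=> n s; rewrite dnbhs; exists (e n) => //= t; exact: ltW.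
- move=> n s t ct; apply/ler_addgt0Pr => r r0.
  have tr : nbhs t [set t' | d t t' < r] by rewrite dnbhs; exists r.
  have [t' [/= st' tt']] := ct _ tr.
  by have := dT s t' t; rewrite (dC t' t); move: st'; rewrite /c /=; lra.
- move=> s N; rewrite dnbhs => -[r /= r0 rN]; have [n nr] := esmall r r0.
  by exists n => t st; apply: rN => /=; exact: le_lt_trans nr.
- move=> n s.
  have sn : nbhs s [set t | d s t < e n.+1] by rewrite dnbhs; exists (e n.+1) => //=.
  have [||y [sy Dy]] := dD [set t | d s t < e n.+1]°.
  + by exists s.
  + exact: open_interior.
  exists (f y), y; split => //; rewrite dC ltW//.
  exact: (interior_subset sy).
- move=> n k s [y [Dy fy ys]] t [y' [Dy' fy' y't]].
  have yy' : y = y' by apply: finj; rewrite ?inE// fy.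
  rewrite -{}yy' in y't; rewrite /c /= eS; have := dT s y t.
  by rewrite (dC s y); lra.
move=> u uc; apply: dcomplete => r r0.
have [N Nr] := esmall (r / 4) (divr_gt0 r0 (ltr0Sn _ 3)).
(* The geometric sum of the steps from [N] to [n]; two such sums total at most [4 * e N < r]. *)
have uN n : (N <= n)%N -> d (u N) (u n) <= 2 * e N - 2 * e n.
  elim: n => [|n IHn]; first by rewrite leqn0 => /eqP->; rewrite dxx; lra.
  rewrite leq_eqVlt => /predU1P[<-|/IHn Nn]; first by rewrite dxx; lra.
  have := dT (u N) (u n) (u n.+1); have := uc n; rewrite /c /= => h1 h2.
  by have := eS n; lra.
exists N => m n Nm Nn; have := dT (u m) (u N) (u n); rewrite (dC (u m) (u N)).
by have := uN m Nm; have := uN n Nn; have := e0 m; have := e0 n; lra.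
Qed.

End Polish.

(** Inverses are compared as well, so that limits of Cauchy sequences are again permutations. At the
    identity these sets are the pointwise stabilizers of the first [n] integers, hence subgroups. *)
Definition Sinf_agree (n : nat) (s : Sinf) : set Sinf :=
  [set t | forall i, (i < n)%N -> Defs.sfun t i = Defs.sfun s i /\ sinv t i = sinv s i].

Lemma nbhs_Sinf_agree n s : nbhs s (Sinf_agree n s).
Proof.
elim: n => [|n IHn]; first by apply: filterS filterT.
have sn : nbhs s [set t | sinv t n = sinv s n].
  exact: (@Sinf_invg_continuous s _ (nbhs_Sinf_eval (s^-1)%g n)).
apply: filterS (filterI IHn (filterI (nbhs_Sinf_eval s n) sn)) => t [tP [t1 t2]] i.
by rewrite ltnS leq_eqVlt => /predU1P[->//|]; exact: tP.
Qed.

Lemma Sinf_agree_small (s : Sinf) (N : set Sinf) : nbhs s N ->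
  exists n, Sinf_agree n s `<=` N.
Proof.
pose F : set_system Sinf := filter_from setT (Sinf_agree^~ s).
have FF : Filter F.
  apply: filter_from_filter; first by exists 0%N.
  move=> m n _ _; exists (maxn m n) => // t tP.
  by split => i im; apply: tP; rewrite (leq_trans im)// (leq_maxl, leq_maxr).
move=> [_ [[B oB <-] /= Bs] BN].
have Fs : (fmap (Defs.sfun : Sinf -> {ptws nat -> nat}) F) -->
    (Defs.sfun s : {ptws nat -> nat}).
  apply/cvg_sup => n; apply/cvg_image; first by apply/seteqP; split => // k _; exists (fun=> k).
  move=> A; rewrite /= nbhs_principalE => /principal_filterP An.
  exists [set g : nat -> nat | A (g n)].
    by exists n.+1 => // t /(_ n (ltnSn n))[/= -> _].
  by apply/seteqP; split=> [k [g /= Ag <-//]|k Ak]; exists (fun=> k).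
have [|n _ nB] := Fs B; first exact: open_nbhs_nbhs.
by exists n => t /nB; exact: BN.
Qed.

Lemma Sinf_agree_complete (u : Sinf^nat) : (forall n, Sinf_agree n (u n) (u n.+1)) ->
  exists l : Sinf, u @ \oo --> l.
Proof.
move=> uc.
have uS n m i : (i < n)%N -> (n <= m)%N ->
    Defs.sfun (u m) i = Defs.sfun (u n) i /\ sinv (u m) i = sinv (u n) i.
  move=> ilen; elim: m => [|m IHm]; first by rewrite leqn0 => /eqP->.
  rewrite leq_eqVlt => /predU1P[->//|]; rewrite ltnS => nm.
  by have [-> ->] := uc m i (leq_trans ilen nm); exact: IHm.
pose l i := Defs.sfun (u i.+1) i; pose l' i := sinv (u i.+1) i.
have lE n i : (i < n)%N -> Defs.sfun (u n) i = l i /\ sinv (u n) i = l' i by exact: uS.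
have lK : cancel l l'.
  (* By stage [n] the entries at [i] and at [l i] have both stabilised. *)
  move=> i; pose n := maxn i.+1 (l i).+1.
  have [_ <-] := lE n (l i) (leq_maxr _ _).
  by have [<- _] := lE n i (leq_maxl _ _); rewrite sfunK.
have lK' : cancel l' l.
  move=> i; pose n := maxn i.+1 (l' i).+1.
  have [<- _] := lE n (l' i) (leq_maxr _ _).
  by have [_ <-] := lE n i (leq_maxl _ _); rewrite sinvK.
exists (MkSinf lK lK') => N /Sinf_agree_small[n nN].
by exists n => // m /= nm; apply: nN => i ilen; apply: lE; exact: leq_trans nm.
Qed.

Lemma closed_Sinf_agree n s : closed (Sinf_agree n s).
Proof.
move=> t ct i ilen; have [t' [st' tt']] := ct _ (nbhs_Sinf_agree n t).
have [<- <-] := st' i ilen; by have [-> ->] := tt' i ilen.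
Qed.

Definition Sinf_complete_base : complete_base Sinf.
Proof.
pose code n (t : Sinf) := pickle (mkseq (Defs.sfun t) n, mkseq (sinv t) n).
apply: (@Build_complete_base _ Sinf_agree (fun n k => [set t | code n t = k])).
- exact: nbhs_Sinf_agree.
- exact: closed_Sinf_agree.
- exact: Sinf_agree_small.
- by move=> n s; exists (code n s).
- move=> n _ s <- t /(pcan_inj pickleK)[/eq_in_map tf /eq_in_map tg] i ilen.
  by split; [apply: tf | apply: tg]; rewrite mem_iota.
- exact: Sinf_agree_complete.
Defined.

Lemma Sinf_agree1M n g h : Sinf_agree n 1%g g -> Sinf_agree n 1%g h ->
  Sinf_agree n 1%g (g * h)%g.
Proof.
move=> gP hP i ilen; have [/= g1 g2] := gP i ilen; have [/= h1 h2] := hP i ilen.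
by rewrite h1 g1 g2 h2.
Qed.

Section Turbulence.
Context {R : realType}.
Notation X := (CR R).

Lemma Einf_class_dense (x : X) : dense [set y | merel (dinf_metric R) x y].
Proof.
move=> O O0 oO; have [y [B [Oy yB]]] := dense_truncate x oO O0.
by exists y; split => //; apply: Einf_sym; exact: Einf_bounded yB.
Qed.

Lemma Einf_class_meager (x : X) : meager [set y | merel (dinf_metric R) x y].
Proof.
pose F (n : nat) := [set y : X | forall r, `|y r - x r| <= n%:R].
apply: (@meager_sub _ _ (\bigcup_n F n)).
  move=> y /Einf_sym/Einf_bound[B yB]; exists (Num.truncn B).+1 => // r.
  by rewrite (le_trans (yB r))// ltW// truncnS_gt.
apply: meager_bigcup => n; apply: nowhere_dense_meager.
have clF : closure (F n) `<=` F n.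
  move=> y yF r; apply/ler_addgt0Pr => e e0.
  have [z [zF /= zy]] := yF _ (nbhs_eval y r e0).
  have := ler_distD (z r) (y r) (x r); rewrite (distrC (y r) (z r)).
  by have := zF r; lra.
rewrite /nowhere_dense -subset0 => y /nbhsCR[m [d d0 dF]].
(* Every neighbourhood of [y] contains a function bent, outside the interval it sees, to distance
   [n.+1] from [x]. *)
have [h hy hm] := CR_bend y m (x m.+1%:R + n.+1%:R).
have /dF/clF/(_ m.+1%:R) : tube y m d h.
  by move=> r rm; rewrite hy// subrr normr0 ltW.
by rewrite hm addrC addKr normr_nat ler_nat ltnn.
Qed.

Lemma Einf_local_class (U : set X) (V : set (X * X)) (x : X) : open U ->
  meentourage (dinf_metric R) V -> U x ->
  somewhere_dense (local_class U V x).
Proof.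
move=> oU [e /= e0 eV] Ux; have [m [d d0 dU]] := nbhsCR (open_nbhs_nbhs (conj oU Ux)).
have local y (B : R) : tube x m d y -> (forall r, `|y r - x r| <= B) -> local_class U V x y.
  move=> xy xyB; have e2 : 0 < e / 2 by rewrite divr_gt0.
  have [K [z [z0 zK zx zS]]] := CR_segment e2 xyB xy.
  (* [relation_power] puts each new step in front, so the chain is built backwards from [z K]. *)
  suff /(_ K (leqnn K)) : forall i, (i <= K)%N ->
      relation_power (V `&` U `*` U) i (z (K - i)%N, z K).
    by rewrite subnn z0 zK => xyK; exists K.
  elim=> [_|i IHi iK]; first by rewrite subn0.
  exists (z (K - i)%N); last exact/IHi/ltnW.
  rewrite -(subnSK iK) /=; split; last first.
    split; apply: dU; apply: zx; first exact: leq_subr.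
    by rewrite subnSK//; exact: leq_subr.
  apply: eV; apply: (@le_lt_trans _ _ (e / 2)%:E).
    by apply: ge_ereal_sup => _ [r _ <-]; rewrite lee_fin distrC; exact: zS.
  by rewrite lte_fin gtr_pMr// invf_lt1// ltr1n.
exists x; apply: filterS (nbhs_tube x m d0) => y xy P /nbhsCR[p [q q0 qP]].
(* [local] covers only functions at bounded distance from [x]; truncations approximate the others,
   so the whole tube lies in the closure. *)
have [T T0 TE] := truncate_agree x y (maxn m p).
exists (truncate x y T); split.
  apply: (local _ T); last by move=> r; apply: truncate_le; exact: ltW.
  by move=> r rm; rewrite TE ?xy// (le_trans rm)// ler_nat leq_maxl.
apply: qP => r rp; rewrite TE; first by rewrite subrr normr0 ltW.
by rewrite (le_trans rp)// ler_nat leq_maxr.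
Qed.

End Turbulence.

Theorem theorem7p1 (R : realType) :
  [/\ turbulent (dinf_metric R),
      forall (Y : topologicalType) (a : continuous_action Sinf Y),
        polish R Y -> generically_ergodic (@Einf R) (orbit_relation a) &
      forall (G : topologicalGroupType) (Y : topologicalType)
          (a : continuous_action G Y),
        polish R G -> polish R Y ->
        ~ Borel_reducible (@Einf R) (orbit_relation a)].
Proof.
split.
- split; [exact: Einf_class_dense | exact: Einf_class_meager |].
  by move=> U V oU _ eV _ x Ux; exact: Einf_local_class.
- move=> Y a pY f f_inv mf.
  have [V odV fV] := Baire_measurable_continuous (polish_second_countable pY) mf.
  have [Z rZ ZZ] := generic_orbit_relation (c := Sinf_complete_base)
    (polish_hausdorff pY) f_inv odV fV (fun n i _ => conj erefl erefl) (@Sinf_agree1M).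
  have [x0 [_ Zx0]] := Baire_space_nbhs (@CR_Baire_space R) rZ (@filterT _ (nbhs CR0) _).
  (* The full preimage of one orbit: it contains the residual [Z], and invariance of [f] makes it
     saturated. *)
  exists [set x | orbit_relation a (f x0) (f x)]; split.
  + by apply: residual_sub rZ => x; exact: ZZ.
  + move=> x x' [g gx] /f_inv[h hx]; exists (h * g)%g.
    by rewrite actM gx.
  + by exists (f x0) => _ [x fx <-].
- move=> G Y a pG pY [f [f_inv /Borel_Baire_measurable mf fE]].
  have [V odV fV] := Baire_measurable_continuous (polish_second_countable pY) mf.
  have [c] := polish_complete_base pG.
  exact: (orbit_relation_not_Einf c (polish_hausdorff pY) f_inv odV fV fE).
Qed.
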